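(* Let $\xi_1,\dots,\xi_n$ be independent integer-valued random variables with finite second moments, let $W=\sum_{i=1}^n\xi_i$, $W_i=W-\xi_i$, $\sigma_i^2=\mathrm{Var}(\xi_i)$, $\mu=\mathbb{E}(W)$, and $\sigma^2=\mathrm{Var}(W)>0$. For each $i$ let $\xi_i^\star$ be defined on the same space as $\xi_i$ and have the discrete $\xi_i$-zero biased distribution (if $\sigma_i^2=0$, the $i$-th summand in every sum over $i$ below is taken to be $0$ and no $\xi_i^\star$ is needed). Let $d_+^{(i)}=d_{\mathrm{TV}}(\mathcal{L}(W_i),\mathcal{L}(W_i+1))$, $i=1,\dots,n$. Then for any $K>0$, $$\begin{aligned}d_{\mathrm{TV}}(\mathcal{L}(W),\Psi(\mu,\sigma^2))\le{}&\frac{2}{\sigma^2}\sum_{i=1}^n\sigma_i^2d_+^{(i)}\left[\mathbb{E}(|\xi_i-\xi_i^\star|\wedge K)+\mathbb{E}(|\xi_i-(\xi_i^\star+1)|\wedge K)\right]\\&+\frac{2}{\sigma^2}\sum_{i=1}^n\sigma_i^2\left\{\sum_{|k_1-k_2|>K}\mathbb{P}(\xi_i=k_1,\xi_i^\star=k_2)+\sum_{|k_1-k_2|>K}\mathbb{P}(\xi_i=k_1,\xi_i^\star+1=k_2)\right\},\end{aligned}$$ where the inner sums run over $k_1,k_2\in\mathbb{Z}$ with $|k_1-k_2|>K$. In particular, $$d_{\mathrm{TV}}(\mathcal{L}(W),\Psi(\mu,\sigma^2))\le\frac{2}{\sigma^2}\sum_{i=1}^n\sigma_i^2d_+^{(i)}\left[\mathbb{E}|\xi_i-\xi_i^\star|+\mathbb{E}|\xi_i-(\xi_i^\star+1)|\right],$$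 and the right-hand side of this last inequality is finite when $\mathbb{E}|\xi_i|^3<\infty$ for $i=1,\dots,n$.
   Context: $\mathcal{L}(X)$ denotes the distribution of $X$; $a\wedge b=\min\{a,b\}$. For probability measures $\mathbf{Q}_1,\mathbf{Q}_2$ on $\mathbb{Z}$, $d_{\mathrm{TV}}(\mathbf{Q}_1,\mathbf{Q}_2)=\sup_{A\subset\mathbb{Z}}|\mathbf{Q}_1(A)-\mathbf{Q}_2(A)|$. Discrete zero bias: for a function $f:\mathbb{Z}\to\mathbb{R}$ let $\Delta f(i)=f(i+1)-f(i)$. For an integer-valued random variable $Y$ with mean $m$ and finite variance $s^2>0$, an integer-valued random variable $Y^\star$ has the discrete $Y$-zero biased distribution if $\mathbb{E}[(Y-m)f(Y)]=s^2\,\mathbb{E}\Delta f(Y^\star)$ for all bounded $f:\mathbb{Z}\to\mathbb{R}$. This distribution exists and is unique; it is given by $\mathbb{P}(Y^\star=j-1)=\mathbb{E}[(Y-m)\mathbf{1}_{(Y\ge j)}]/s^2$, $j\in\mathbb{Z}$. The distribution $\Psi_\kappa(\mu,\sigma^2)$: for $\mu\in\mathbb{R}$, $\sigma^2>0$ and an integer $\kappa$ with $\mu-\sigma^2\le\kappa<\mu+\sigma^2+1$, define for functions $f$ on $\mathbb{Z}$ $$\mathcal{B}f(i)=\begin{cases}\sigma^2f(i+1)-(\sigma^2+i-\mu)f(i), & i\ge\kappa,\\ (\sigma^2+\mu-i)f(i+1)-\sigma^2f(i), & i\le\kappa-1.\end{cases}$$ $\Psi_\kappa(\mu,\sigma^2)$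 is the unique distribution of an integer-valued random variable $S$ such that $\mathbb{E}\mathcal{B}f(S)=0$ for all bounded $f:\mathbb{Z}\to\mathbb{R}$. Explicitly, $\pi_j=\mathbb{P}(S=j)$ satisfies $\pi_j=\left(\prod_{i=\kappa+1}^{j}\frac{\sigma^2}{\sigma^2+i-\mu}\right)\pi_\kappa$ for $j\ge\kappa+1$, $\pi_{\kappa-1}=\frac{\sigma^2+\kappa-\mu}{\sigma^2+\mu-\kappa+1}\pi_\kappa$, $\pi_j=\left(\prod_{i=j}^{\kappa-2}\frac{\sigma^2}{\sigma^2+\mu-i}\right)\pi_{\kappa-1}$ for $j\le\kappa-2$, with $\pi_\kappa$ determined by $\sum_{j\in\mathbb{Z}}\pi_j=1$. We write $\Psi(\mu,\sigma^2)$ for $\Psi_\kappa(\mu,\sigma^2)$ with the choice $\kappa=\min\{i\in\mathbb{Z}:i\ge\mu\}$. *)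

(* Defs.v *)
From HB Require Import structures.
From mathcomp Require Import all_boot all_order all_algebra.
From mathcomp Require Import all_classical all_reals all_analysis.
From mathcomp Require Import ring lra zify.

Set Implicit Arguments.
Unset Strict Implicit.
Unset Printing Implicit Defensive.

Import Order.TTheory GRing.Theory Num.Theory.
Import numFieldNormedType.Exports.

Local Open Scope classical_set_scope.
Local Open Scope ring_scope.

HB.instance Definition _ := isPointed.Build int 0.

(* The discrete sigma-algebra on int, as the library does for nat and bool *)
HB.instance Definition _ := @isMeasurable.Build default_measure_display
  int discrete_measurable discrete_measurable0
  discrete_measurableC discrete_measurableU.

Section integer_valued_random_variables.
Context d (T : measurableType d).

Lemma measurable_fun_int2 (h : int -> int -> int) (f g : T -> int) :
  measurable_fun setT f -> measurable_fun setT g ->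
  measurable_fun setT (fun w => h (f w) (g w)).
Proof.
move=> mf mg _ A _; rewrite setTI.
have -> : (fun w => h (f w) (g w)) @^-1` A =
    \bigcup_k (if unpickle k is Some c
       then if h c.1 c.2 \in A
         then (f @^-1` [set c.1]) `&` (g @^-1` [set c.2]) else set0
       else set0).
  apply/seteqP; split => [w Aw|w [k _]].
    by exists (pickle (f w, g w)) => //; rewrite pickleK /= mem_set.
  by case: unpickle => // -[a b] /=; case: ifPn => // /set_mem Ah [-> ->].
apply: bigcup_measurable => k _; case: unpickle => // -[a b] /=.
by case: ifPn => // _; apply: measurableI; rewrite -[X in measurable X]setTI;
  [exact: mf|exact: mg].
Qed.

Definition rv_sum n (xi : 'I_n -> {mfun T >-> int}) (w : T) : int :=
  \sum_(i < n) xi i w.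

Lemma measurable_rv_sum n (xi : 'I_n -> {mfun T >-> int}) :
  measurable_fun setT (rv_sum xi).
Proof.
rewrite /rv_sum; elim: (index_enum _) => [|i r IH].
  by under eq_fun do rewrite big_nil; exact: measurable_cst.
under eq_fun do rewrite big_cons.
by apply: (@measurable_fun_int2 +%R).
Qed.

HB.instance Definition _ n xi :=
  isMeasurableFun.Build _ _ _ _ (@rv_sum n xi) (measurable_rv_sum xi).

Definition rv_sub (X Y : {mfun T >-> int}) (w : T) : int := X w - Y w.

Lemma measurable_rv_sub X Y : measurable_fun setT (rv_sub X Y).
Proof. by apply: (@measurable_fun_int2 (fun a b => a - b)). Qed.

HB.instance Definition _ X Y :=
  isMeasurableFun.Build _ _ _ _ (rv_sub X Y) (measurable_rv_sub X Y).

Definition rv_succ (X : {mfun T >-> int}) (w : T) : int := X w + 1.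

Lemma measurable_rv_succ X : measurable_fun setT (rv_succ X).
Proof. by apply: (@measurable_fun_int2 (fun a _ => a + 1) X X). Qed.

HB.instance Definition _ X :=
  isMeasurableFun.Build _ _ _ _ (rv_succ X) (measurable_rv_succ X).

Context (R : realType) (P : probability T R).

Definition rv_mean (X : {RV P >-> int}) : R := fine 'E_P[fun w => (X w)%:~R].

Definition rv_var (X : {RV P >-> int}) : R := fine 'V_P[fun w => (X w)%:~R].

Definition mutually_independent n (xi : 'I_n -> {RV P >-> int}) :=
  forall (J : {set 'I_n}) (A : 'I_n -> set int),
    P (\bigcap_(i in [set` J]) xi i @^-1` A i) =
    (\prod_(i in J) P (xi i @^-1` A i))%E.

Definition fdiff (f : int -> R) (i : int) : R := f (i + 1) - f i.

Definition zero_biased (Y Ystar : {RV P >-> int}) :=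
  forall f : int -> R, bounded_fun f ->
    ('E_P[fun w => (((Y w)%:~R - rv_mean Y) * f (Y w))%R] =
     (rv_var Y)%:E * 'E_P[fun w => fdiff f (Ystar w)])%E.

End integer_valued_random_variables.

Definition dTV (R : realType) (Q1 Q2 : probability int R) : \bar R :=
  ereal_sup [set `|Q1 A - Q2 A|%E | A in [set: set int]].

Section Psi.
Context {R : realType}.
Implicit Types (mu var : R) (kappa : int) (f : int -> R).

Definition stein_op kappa mu var f (i : int) : R :=
  if kappa <= i then var * f (i + 1) - (var + i%:~R - mu) * f i
  else (var + mu - i%:~R) * f (i + 1) - var * f i.

Definition is_Psi kappa mu var (Q : probability int R) : Prop :=
  forall f, bounded_fun f -> (\int[Q]_i (stein_op kappa mu var f i)%:E = 0)%E.

(* Psi_kappaP below shows that such a distribution exists and is unique when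
   0 < var and mu - var <= kappa < mu + var + 1. *)
Definition Psi_kappa kappa mu var : probability int R :=
  get (is_Psi kappa mu var).

(* Num.ceil mu is the least integer i such that mu <= i *)
Definition Psi mu var : probability int R := Psi_kappa (Num.ceil mu) mu var.

End Psi.

Section Psi_weights.
Context {R : realType} (s : R) (s_gt0 : 0 < s).

(* With a = var + kappa - mu and b = var + mu - kappa + 1, the explicit weights
   are pi_(kappa + n) = cf a n * pi_kappa and
   pi_(kappa - 1 - n) = a / b * cf b n * pi_kappa. *)
Let cf (a : R) (n : nat) : R := \prod_(k < n) (s / (a + k.+1%:R)).

Let cfS a n : 0 <= a -> cf a n.+1 * (a + n.+1%:R) = s * cf a n.
Proof.
move=> a0; rewrite /cf big_ord_recr /= -mulrA mulrC divfK//.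
by rewrite gt_eqF// ltr_wpDl.
Qed.

Let cf_ge0 a n : 0 <= a -> 0 <= cf a n.
Proof.
by move=> a0; apply: prodr_ge0 => k _; rewrite divr_ge0 ?addr_ge0// ltW.
Qed.

Let cf_le a n : 0 <= a -> cf a n <= exp_coeff s n.
Proof.
move=> a0; elim: n => [|n IH]; first by rewrite /cf big_ord0 /exp_coeff/= divr1.
have -> : exp_coeff s n.+1 = exp_coeff s n * (s / n.+1%:R).
  by rewrite /exp_coeff/= factS natrM exprSr invfM [RHS]mulrACA;
    congr (_ * _); exact: mulrC.
rewrite /cf big_ord_recr/= -/(cf a n) ler_pM ?cf_ge0//.
  by rewrite divr_ge0 ?addr_ge0// ltW.
by rewrite ler_pM2l// lef_pV2 ?posrE ?ltr_wpDl// lerDr.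
Qed.

Let cf_lin_le a n : 0 <= a ->
  cf a n * (a + n.+1%:R) <= (a + 1) * exp_coeff (2 * s) n.
Proof.
move=> a0; have -> : exp_coeff (2 * s) n = 2 ^+ n * exp_coeff s n.
  by rewrite /exp_coeff/= exprMn mulrA.
rewrite mulrCA mulrA [leRHS]mulrC ler_pM ?cf_ge0 ?addr_ge0 ?cf_le//.
rewrite mulrC; apply: (@le_trans _ _ ((a + 1) * n.+1%:R)).
  have n1 : 1 <= n.+1%:R :> R by rewrite ler1n.
  by nra.
by rewrite ler_pM2l ?ltr_wpDl// -natrX ler_nat ltn_expl.
Qed.

Let exp_coeff_le n : exp_coeff s n <= exp_coeff (2 * s) n.
Proof.
rewrite /exp_coeff/= exprMn ler_pM2r ?invr_gt0 ?ltr0n ?fact_gt0//.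
by rewrite ler_peMl ?exprn_ge0 ?(ltW s_gt0)// exprn_ege1// ler1n.
Qed.

Context (mu : R) (kappa : int).
Hypotheses (lo : mu - s <= kappa%:~R) (hi : kappa%:~R < mu + s + 1).

Let a := s + kappa%:~R - mu.
Let b := s + mu - kappa%:~R + 1.
Let a_ge0 : 0 <= a. Proof. by rewrite subr_ge0 -lerBlDl. Qed.
Let b_gt0 : 0 < b. Proof. by move: hi; rewrite /b -subr_gt0; congr (_ < _); ring. Qed.

Let u n := cf a n.
Let v n := a / b * cf b n.
Let ab_ge0 : 0 <= a / b. Proof. by rewrite divr_ge0// ltW. Qed.
Let u_ge0 n : 0 <= u n. Proof. exact: cf_ge0. Qed.
Let v_ge0 n : 0 <= v n. Proof. by rewrite mulr_ge0// cf_ge0// ltW. Qed.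

Let r (n : nat) : int := kappa + n%:Z.
Let l (n : nat) : int := kappa - 1 - n%:Z.

Let m_ n : {measure set int -> \bar R} :=
  measure_add (mscale (NngNum (u_ge0 n)) \d_(r n))
              (mscale (NngNum (v_ge0 n)) \d_(l n)).
Let m : {measure set int -> \bar R} := mseries m_ 0.

Let mE A : m A = (\sum_(n <oo)
  (u n * \1_A (r n) + v n * \1_A (l n))%:E)%E.
Proof.
apply: eq_eseriesr => n _; apply: (etrans (measure_addE _ _ _)).
by rewrite /= /mscale /= !diracE !indicE EFinD !EFinM.
Qed.

Let W g n : R := u n * g (r n) + v n * g (l n).

Let ge0_integral_m (g : int -> R) : (forall i, 0 <= g i) ->
  cvgn (series (W g)) ->
  (\int[m]_i (g i)%:E = (limn (series (W g)))%:E)%E.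
Proof.
move=> g0 cg; rewrite ge0_integral_measure_series//=; last first.
  by move=> i _; rewrite lee_fin.
rewrite -EFin_lim//; apply/congr_lim/funext => N /=.
rewrite -sumEFin /series/=; apply: eq_bigr => n _.
rewrite ge0_integral_measure_add//=; last by move=> i _; rewrite lee_fin.
rewrite !ge0_integral_mscale//=; try by move=> i _; rewrite lee_fin.
by rewrite !integral_dirac//= !diracE !in_setT !mul1e.
Qed.

Let integral_m (c : {nonneg R}) (g : int -> R) :
  cvgn [normed series (W (fun i => `|g i|))] ->
  (\int[mscale c m]_i (g i)%:E = (c%:num * limn (series (W g)))%:E)%E.
Proof.
set h := fun i => `|g i|.
have W0 (k : int -> R) n : (forall i, 0 <= k i) -> 0 <= W k n.
  by move=> k0; apply: addr_ge0; apply: mulr_ge0; rewrite ?u_ge0 ?v_ge0 ?k0.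
have Wh0 n : 0 <= W h n by apply: W0 => i; exact: normr_ge0.
have -> : [normed series (W h)] = series (W h).
  by apply/funext => N /=; apply: eq_bigr => n _; rewrite ger0_norm.
move=> ch.
pose p i := Num.max (g i) 0; pose q i := Num.max (- g i) 0.
have p0 i : 0 <= p i by rewrite le_max lexx orbT.
have q0 i : 0 <= q i by rewrite le_max lexx orbT.
have ph i : p i <= h i by rewrite /p ge_max normr_ge0 ler_norm.
have qh i : q i <= h i by rewrite /q /h ge_max normr_ge0 -normrN ler_norm.
have gpq i : g i = p i - q i by rewrite /p /q /Num.max; do 2 case: ltP => ?; lra.
have cW (k : int -> R) : (forall i, 0 <= k i) -> (forall i, k i <= h i) ->
    cvgn (series (W k)).
  move=> k0 kh; apply: series_le_cvg ch => // n.
    exact: W0.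
  by rewrite lerD ?ler_wpM2l ?u_ge0 ?v_ge0.
have {}cp := cW _ p0 ph; have {}cq := cW _ q0 qh.
rewrite integralE.
rewrite (@eq_integral _ _ _ _ setT (fun i => (p i)%:E)); last first.
  by move=> i _; rewrite funeposE EFin_max.
rewrite (@eq_integral _ _ _ _ setT (fun i => (q i)%:E) (_^\-)%E); last first.
  by move=> i _; rewrite funenegE EFin_max.
rewrite !ge0_integral_mscale//=; try by move=> i _; rewrite lee_fin.
rewrite !ge0_integral_m// -!EFinM -EFinB -mulrBr; congr (_ * _)%:E.
rewrite -(lim_seriesB cp cq); congr (limn (series _)); apply/funext => n.
by rewrite /W !fctE !gpq; ring.
Qed.

Let cvg_W (g : int -> R) K : (forall n, `|W g n| <= K * exp_coeff (2 * s) n) ->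
  cvgn [normed series (W g)].
Proof.
move=> gK; apply: (@series_le_cvg _ _ (fun n => K * exp_coeff (2 * s) n)) => //.
- by move=> n; exact: normr_ge0.
- by move=> n; exact: le_trans (normr_ge0 _) (gK n).
- have -> : (fun n => K * exp_coeff (2 * s) n) = K *: exp_coeff (2 * s) by [].
  by apply: is_cvg_seriesZ; exact: is_cvg_series_exp_coeff.
Qed.

Let u_le n : u n <= exp_coeff (2 * s) n.
Proof. by apply: le_trans (exp_coeff_le n); exact: cf_le. Qed.

Let v_le n : v n <= a / b * exp_coeff (2 * s) n.
Proof.
rewrite ler_wpM2l//; apply: le_trans (exp_coeff_le n).
by apply: cf_le; exact: ltW.
Qed.

Let ua_le n : u n * (a + n.+1%:R) <= (a + 1) * exp_coeff (2 * s) n.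
Proof. exact: cf_lin_le. Qed.

Let vb_le n : v n * (b + n.+1%:R) <= a / b * (b + 1) * exp_coeff (2 * s) n.
Proof.
rewrite /v -[leLHS]mulrA -[leRHS]mulrA; apply: ler_wpM2l => //.
by apply: cf_lin_le; exact: ltW.
Qed.

Let uS n : u n.+1 * (a + n.+1%:R) = s * u n.
Proof. exact: cfS. Qed.

Let vS n : v n.+1 * (b + n.+1%:R) = s * v n.
Proof. by rewrite -mulrA cfS ?(ltW b_gt0)// mulrCA. Qed.

Let stein_r f n : stein_op kappa mu s f (r n) =
  s * f (r n.+1) - (a + n%:R) * f (r n).
Proof.
rewrite /stein_op ifT ?lerDl//; congr (_ * f _ - _ * _).
  by rewrite /r; lia.
by rewrite /a /r intrD; ring.
Qed.

Let stein_l f n : stein_op kappa mu s f (l n) =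
  (b + n%:R) * f (l n + 1) - s * f (l n).
Proof.
rewrite /stein_op ifF; last by apply/negbTE; rewrite -ltNge /l; lia.
by congr (_ * _ - _); rewrite /b /l !intrB; ring.
Qed.

Let D f n : R := u n * (a + n%:R) * f (r n) - v n * (b + n%:R) * f (l n + 1).

Let DS f n : D f n.+1 = s * (u n * f (r n.+1) - v n * f (l n)).
Proof.
rewrite /D uS vS; have -> : l n.+1 + 1 = l n by rewrite /l; lia.
by ring.
Qed.

Let W_stein f n : W (stein_op kappa mu s f) n = D f n.+1 - D f n.
Proof. by rewrite DS /W stein_r stein_l /D; ring. Qed.

Let D0 f : D f 0 = 0.
Proof.
rewrite /D /u /v /cf !big_ord0 /r /l !addr0 subrK !mulr1 mul1r divfK ?subrr//.
by rewrite gt_eqF.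
Qed.

Let D_cvg f M : (forall i, `|f i| <= M) -> D f @ \oo --> 0.
Proof.
move=> fM; rewrite -cvg_shiftS.
have M0 : 0 <= M by exact: le_trans (normr_ge0 _) (fM 0).
have bnd n : `|D f n.+1| <= s * (1 + a / b) * M * exp_coeff (2 * s) n.
  have -> : s * (1 + a / b) * M * exp_coeff (2 * s) n =
      s * (exp_coeff (2 * s) n * M + (a / b * exp_coeff (2 * s) n) * M) by ring.
  rewrite DS normrM gtr0_norm// ler_wpM2l ?(ltW s_gt0)//.
  apply: (le_trans (ler_normB _ _)).
  rewrite (normrM (u n)) (normrM (v n)) (ger0_norm (u_ge0 _)) (ger0_norm (v_ge0 _)).
  by rewrite lerD// ler_pM.
apply/norm_cvg0P; apply: (@squeeze_cvgr _ _ _ _ (cst 0)); last 2 first.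
- exact: cvg_cst.
- rewrite -[X in _ --> X](mulr0 (s * (1 + a / b) * M)).
  by apply: cvgMr; exact: (cvg_exp_coeff (2 * s)).
by near=> n; rewrite normr_ge0 /= bnd.
Unshelve. all: by end_near. Qed.

Let W_stein_le f M n : (forall i, `|f i| <= M) ->
  `|W (fun i => `|stein_op kappa mu s f i|) n| <=
  ((s + (a + 1)) * M + (a / b * (s + (b + 1))) * M) * exp_coeff (2 * s) n.
Proof.
move=> fM; have M0 : 0 <= M by exact: le_trans (normr_ge0 _) (fM 0).
have bound (w c K : R) i j : 0 <= w -> 0 <= c -> w * s + w * c <= K ->
   w * `|c * f i - s * f j| <= K * M.
  move=> w0 c0 wK; apply: le_trans _ (ler_wpM2r M0 wK).
  rewrite -mulrDr -mulrA ler_wpM2l//.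
  apply: (le_trans (ler_normB _ _)).
  rewrite !normrM (ger0_norm c0) (gtr0_norm s_gt0).
  by rewrite mulrDl addrC lerD// ler_wpM2l// ltW.
rewrite ger0_norm; last by rewrite addr_ge0// mulr_ge0.
rewrite [leRHS]mulrDl; apply: lerD.
  rewrite stein_r distrC mulrAC; apply: bound => //.
  - by rewrite addr_ge0.
  - rewrite [leRHS]mulrDl; apply: lerD.
      by rewrite mulrC; apply: ler_wpM2l; [exact: ltW|exact: u_le].
    by apply: le_trans _ (ua_le n); rewrite ler_wpM2l// lerD2l ler_nat.
rewrite stein_l [leRHS]mulrAC; apply: bound => //.
- by rewrite addr_ge0// ltW.
- rewrite (mulrDr (a / b)) [leRHS]mulrDl; apply: lerD.
    have -> : a / b * s * exp_coeff (2 * s) n =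
        (a / b * exp_coeff (2 * s) n) * s by ring.
    by apply: ler_wpM2r; [exact: ltW|exact: v_le].
  by apply: le_trans _ (vb_le n); rewrite ler_wpM2l// lerD2l ler_nat.
Qed.

Let Z : R := limn (series (W (cst 1))).

Let cvg_Z : cvgn (series (W (cst 1))).
Proof.
apply: normed_cvg; apply: (@cvg_W _ (1 + a / b)) => n.
rewrite /W /= !mulr1 ger0_norm ?addr_ge0// mulrDl mul1r.
by rewrite lerD.
Qed.

Let Z_gt0 : 0 < Z.
Proof.
apply: (@lt_le_trans _ _ (series (W (cst 1)) 1)).
  rewrite /series/= big_nat1 /W /u /v /cf !big_ord0 !mulr1.
  by rewrite ltr_wpDr.
apply: nondecreasing_cvgn_le => //; apply: nondecreasing_series => n _.
by rewrite /W addr_ge0// mulr_ge0.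
Qed.

Let m_setT : m setT = Z%:E.
Proof.
rewrite -(@ge0_integral_m (cst 1)) //=.
by rewrite integral_cst//= mul1e.
Qed.

Let Q : probability int R := mnormalize m (dirac (0 : int)).

Let QE A : Q A = ((Z^-1)%:E * m A)%E.
Proof.
by rewrite /Q /= /mnormalize m_setT /= eqe gt_eqF//= muleC.
Qed.

Lemma is_Psi_mnormalize : is_Psi kappa mu s Q.
Proof.
move=> f [M0 [_ fM0]].
have {fM0} [M fM] : exists M, forall i, `|f i| <= M.
  exists (M0 + 1) => i; apply: (fM0 (M0 + 1) _ i I).
  by rewrite ltrDl.
have c0 : 0 <= Z^-1 by rewrite invr_ge0 ltW.
rewrite (@eq_measure_integral _ _ _ _ (mscale (NngNum c0) m)); last first.
  by move=> A _ _; exact: QE.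
rewrite integral_m; last by apply: cvg_W => n; exact: W_stein_le fM.
rewrite [limn _](_ : _ = 0) ?mulr0//; apply/cvg_lim => //.
suff -> : series (W (stein_op kappa mu s f)) = D f by exact: D_cvg fM.
apply/funext => n; rewrite /series/=.
by under eq_bigr do rewrite W_stein; rewrite telescope_sumr// D0 subr0.
Qed.

Let fin_P (P : probability int R) (A : set int) : P A \is a fin_num.
Proof. exact: fin_num_measure. Qed.

Let p (P : probability int R) k : R := fine (P [set k]).

Let is_Psi_rec (P : probability int R) k : is_Psi kappa mu s P ->
  (if kappa <= k - 1 then s else s + mu - (k - 1)%:~R) * p P (k - 1) =
  (if kappa <= k then s + k%:~R - mu else s) * p P k.
Proof.
move=> /(_ \1_[set k]) H.
have {H} : (\int[P]_i (stein_op kappa mu s \1_[set k] i)%:E = 0)%E.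
  apply: H; exists 1; split => // M M1 i _ /=.
  by rewrite indicE (le_trans _ (ltW M1))//; case: (_ \in _); rewrite ?normr1 ?normr0.
have in1 (i j : int) : (i \in [set j]%classic) = (i == j).
  by apply/idP/eqP => [/set_mem//|->]; exact/mem_set.
set c1 := if kappa <= k - 1 then _ else _.
set c2 := if kappa <= k then _ else _.
rewrite (_ : (fun i => _) = (fun i => (c1 * \1_[set (k - 1)] i)%:E -
    (c2 * \1_[set k] i)%:E)%E); last first.
  apply/funext => i; rewrite -EFinB; congr EFin.
  rewrite /stein_op !indicE !in1.
  have [->|ik] := eqVneq i k.
    have -> : (k + 1 == k) = false by lia.
    have -> : (k == k - 1) = false by lia.
    by rewrite /c2; case: ifP => _; rewrite ?(mulr0, mulr1, add0r, sub0r).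
  have [->|ik1] := eqVneq i (k - 1).
    by rewrite subrK eqxx /c1; case: ifP => _; rewrite !(mulr0, mulr1, subr0).
  have -> : (i + 1 == k) = false by lia.
  by case: ifP => _; rewrite !mulr0 subrr.
have int1 c j : P.-integrable setT (fun i => (c * \1_[set j] i)%:E).
  rewrite (_ : (fun i => _) = (fun i => c%:E * (\1_[set j] i)%:E)%E)//.
  by apply: integrableZl => //; exact: integrable_indic.
have intE c j : (\int[P]_i (c * \1_[set j] i)%:E = (c * p P j)%:E)%E.
  under eq_integral do rewrite EFinM.
  rewrite integralZl//; last exact: integrable_indic.
  by rewrite integral_indic// setIT EFinM /p fineK.
rewrite integralB// !intE -EFinB => -[] /eqP.
by rewrite subr_eq0 => /eqP.
Qed.

Let is_Psi_r P n : is_Psi kappa mu s P -> p P (r n) = u n * p P kappa.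
Proof.
move=> H; elim: n => [|n IH]; first by rewrite /r /u /cf big_ord0 mul1r addr0.
have := is_Psi_rec (r n.+1) H.
have -> : r n.+1 - 1 = r n by rewrite /r; lia.
rewrite !ifT /r ?lerDl// -/(r _) -/(r _) IH.
have -> : s + (r n.+1)%:~R - mu = a + n.+1%:R by rewrite /a /r intrD; ring.
have an : a + n.+1%:R != 0 by rewrite gt_eqF// ltr_wpDl.
move=> /esym E; apply: (mulfI an); rewrite E mulrA -uS; ring.
Qed.

Let is_Psi_l P n : is_Psi kappa mu s P -> p P (l n) = v n * p P kappa.
Proof.
move=> H; elim: n => [|n IH].
  have := is_Psi_rec kappa H.
  rewrite ifF ?lexx; last by apply/negbTE; rewrite -ltNge; lia.
  have -> : s + mu - (kappa - 1)%:~R = b by rewrite /b intrB; ring.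
  rewrite /l subr0 /v /cf big_ord0 mulr1 -/a => E.
  by rewrite mulrAC -E mulrC mulrA mulVf ?mul1r// gt_eqF.
have := is_Psi_rec (l n) H.
have -> : l n - 1 = l n.+1 by rewrite /l; lia.
rewrite !ifF; try by apply/negbTE; rewrite -ltNge /l; lia.
have -> : s + mu - (l n.+1)%:~R = b + n.+1%:R by rewrite /b /l !intrB; ring.
have bn : b + n.+1%:R != 0 by rewrite gt_eqF// addr_gt0.
move=> E; apply: (mulfI bn); rewrite E IH mulrA -vS; ring.
Qed.

Lemma is_Psi_unique P : is_Psi kappa mu s P -> P =1 Q.
Proof.
move=> H A.
have singl k B : P (B `&` [set k]) = (p P k * \1_B k)%:E.
  rewrite indicE; have [/set_mem Bk|Bk] := boolP (k \in B).
    rewrite mulr1 /p fineK//; congr (P _).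
    by apply/seteqP; split => [i []//|i ->].
  rewrite mulr0 [_ `&` _](_ : _ = set0) ?measure0//.
  by rewrite -subset0 => i [Bi /= ik]; move/negP: Bk; apply; rewrite inE -ik.
have key B : P B = ((p P kappa)%:E * m B)%E.
  have {1}-> : B = \bigcup_n (B `&` [set r n] `|` B `&` [set l n]).
    apply/seteqP; split => [i Bi|i [n _ [[]|[]]]//].
    exists (if kappa <= i then absz (i - kappa)%R else absz (kappa - 1 - i)%R) => //.
    by case: ifP => ?; [left|right]; split => //=; rewrite /r /l; lia.
  rewrite measure_semi_bigcup//; last first.
    apply/trivIsetP => i j _ _ /eqP ij; rewrite -subset0 => k [].
    by rewrite /r /l => -[] [_ /= ->] -[] [_ /= ?]; apply: ij; lia.
  rewrite mE -nneseriesZl; last first.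
    by move=> n _; rewrite lee_fin addr_ge0// mulr_ge0.
  apply: eq_eseriesr => n _.
  transitivity (P (B `&` [set r n]) + P (B `&` [set l n]))%E.
    apply: measureU => //.
    by rewrite -subset0 => k [] [_ /= ->] [_ /=]; rewrite /r /l; lia.
  rewrite !singl is_Psi_r// is_Psi_l// -EFinD -EFinM; congr EFin; ring.
have := key setT; rewrite probability_setT m_setT -EFinM => -[] /esym pZ.
rewrite QE key; congr (_%:E * _)%E.
by apply: (mulIf (lt0r_neq0 Z_gt0)); rewrite pZ mulVf// gt_eqF.
Qed.

Lemma is_Psi_exists_unique : exists Q : probability int R,
  is_Psi kappa mu s Q /\ forall P, is_Psi kappa mu s P -> P =1 Q.
Proof. by exists Q; split; [exact: is_Psi_mnormalize|exact: is_Psi_unique]. Qed.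

End Psi_weights.

Lemma Psi_kappaP (R : realType) (kappa : int) (mu var : R) : 0 < var ->
    mu - var <= kappa%:~R -> kappa%:~R < mu + var + 1 ->
  is_Psi kappa mu var (Psi_kappa kappa mu var) /\
  forall Q, is_Psi kappa mu var Q -> Q =1 Psi_kappa kappa mu var.
Proof.
move=> var0 lo hi; have [Q [PQ uQ]] := is_Psi_exists_unique var0 lo hi.
have PP : is_Psi kappa mu var (Psi_kappa kappa mu var) by apply: getI PQ.
by split => // Q' PQ' A; rewrite (uQ _ PQ') (uQ _ PP).
Qed.

Lemma PsiP (R : realType) (mu var : R) : 0 < var ->
  is_Psi (Num.ceil mu) mu var (Psi mu var) /\
  forall Q, is_Psi (Num.ceil mu) mu var Q -> Q =1 Psi mu var.
Proof.
move=> var0; apply: Psi_kappaP => //.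
  by rewrite (le_trans _ (ceil_ge mu))// gerBl ltW.
have := real_ceilB1_lt (num_real mu); rewrite intrB; lra.
Qed.

(* Main.v *)
From HB Require Import structures.
Require Import Defs.
From mathcomp Require Import all_boot all_order all_algebra.
From mathcomp Require Import all_classical all_reals all_analysis.
From mathcomp Require Import measurable_realfun.
From mathcomp Require Import ring lra zify.

Import Order.TTheory GRing.Theory Num.Theory.
Import numFieldNormedType.Exports.

Local Open Scope classical_set_scope.
Local Open Scope ring_scope.

Set Implicit Arguments.
Unset Strict Implicit.
Unset Printing Implicit Defensive.

(** The argument is Stein's method with discrete zero biasing.  Write
    [kappa] for the ceiling of [mu], [s2] for the variance of [W], and fix a set
    [A] of integers.

    The Stein operator of [Psi mu s2] has the form
    [al i * f (i + 1) - be i * f i], where [al] is nonincreasing, [be] is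
    nondecreasing, both are at least [s2], and the weights of [Psi] satisfy the
    detailed balance equations.  For such birth-death operators the equation
    with right-hand side [\1_A - Psi A] has a bounded solution [f] whose
    increments are at most [1 / s2] in absolute value ([birth_death_stein],
    [Psi_stein]).  Hence [P (W \in A) - Psi A] is the expectation of the
    operator applied to [f] at [W].

    On either side of [kappa] the operator reads
    [s2 * fdiff f i - (i - mu) * g i], where [g i] is [f i] for [kappa <= i] and
    [f (i + 1)] below.  Zero biasing one summand at a time, which uses the
    independence of [xi i] and [W - xi i], turns the expectation of
    [(W - mu) * g W] into the sum over [i] of [Var (xi i)] times the mean of
    [fdiff g] at [W - xi i + xistar i] ([Rintegral_centered_mul_sum]).  Let [hp]
    and [hm] be the parts of [fdiff f] supported on [kappa <= i] and on
    [i < kappa].  Then [fdiff f i = hp i + hm i] while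
    [fdiff g i = hp i + hm (i + 1)]: the shift by one below [kappa] is the
    reason why both [xistar i] and [xistar i + 1] occur in the bound.  What
    remains is to compare the mean of [hp] at [W - xi i + xi i] and at
    [W - xi i + xistar i], and that of [hm] at [W - xi i + xi i] and at
    [W - xi i + (xistar i + 1)].

    For a function bounded by [M] and two integers [a] and [b], the means at
    [X + a] and [X + b] differ by at most [2 * M] and, moving one unit at a
    time, by at most [2 * M * |a - b| * d] where [d] is the total variation
    distance between the laws of [X] and [X + 1] ([Rintegral_shift_le]).
    Averaging [min 1 (d * |a - b|)] over the joint law of the pair gives
    [zero_bias_dTV]; both inequalities of the theorem follow by bounding this
    minimum, either by [d * |a - b|] or by splitting according to whether
    [|a - b|] exceeds [K].  All expectations are first rewritten over an
    independent copy of [W - xi i], which leaves only the joint law of [xi i] and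
    [xistar i] to deal with.

    For the finiteness, zero biasing a truncation of [k * |k|] bounds the first
    absolute moment of [xistar i] by third moments of [xi i]
    ([zero_biased_first_moment]). *)

(** * Measurability and integrability for integer-valued variables *)

Section discrete.
Context d (T : measurableType d).

Lemma measurable_comp_int d' (U : measurableType d') (phi : int -> U)
  (X : {mfun T >-> int}) : measurable_fun setT (fun w => phi (X w)).
Proof. exact: (measurableT_comp _ (measurable_funPT X)). Qed.

(** The joint law of two integer-valued maps lives on a countable discrete set,
    so every function of the pair is measurable; the pair is coded by one
    integer in order to reuse the case of a single map. *)
Lemma measurable_comp_int2 d' (U : measurableType d') (phi : int -> int -> U)
    (f g : T -> int) : measurable_fun setT f -> measurable_fun setT g ->
  measurable_fun setT (fun w => phi (f w) (g w)).
Proof.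
move=> mf mg.
pose code (a b : int) : int := Posz (pickle (a, b) : nat).
pose psi (k : int) : U :=
  if unpickle (absz k) is Some c then phi c.1 c.2 else phi 0 0.
have -> : (fun w => phi (f w) (g w)) = psi \o (fun w => code (f w) (g w)).
  by apply/funext => w /=; rewrite /psi /code /= pickleK.
by apply: measurableT_comp => //; exact: (@measurable_fun_int2 _ _ code).
Qed.

Lemma integrable_bounded (R : realType) (P : probability T R) (f : T -> R) (M : R) :
  measurable_fun setT f -> (forall w, `|f w| <= M) ->
  P.-integrable setT (EFin \o f).
Proof.
move=> mf fM; apply: measurable_bounded_integrable => //.
  by apply: le_lt_trans (probability_le1 P _) (ltry _).
exists M; split; first exact: num_real.
by move=> N MN w _; apply: le_trans (fM w) (ltW MN).
Qed.

Lemma Rintegral_le_bound (R : realType) (P : probability T R) (f : T -> R) (M : R) :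
  measurable_fun setT f -> (forall w, `|f w| <= M) ->
  `|\int[P]_w f w| <= M.
Proof.
move=> mf fM; have If : P.-integrable setT (EFin \o f) := integrable_bounded P mf fM.
apply: (le_trans (le_normr_Rintegral _ If)) => //.
apply: (@le_trans _ _ (\int[P]_(w in setT) M)).
  apply: le_Rintegral => //.
  - apply: (@integrable_bounded _ P _ M); first exact: measurableT_comp.
    by move=> w; rewrite normr_id.
  - by apply: (@integrable_bounded _ P _ `|M|).
by rewrite Rintegral_cst//= probability_setT mulr1.
Qed.

Lemma Rintegral_cstP (R : realType) (P : probability T R) (r : R) :
  \int[P]_w r = r.
Proof. by rewrite Rintegral_cst//= probability_setT mulr1. Qed.

End discrete.

(** * Decomposition of a measure along a countable partition *)

Section fibers.
Local Open Scope ereal_scope.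

(** Countable additivity in the form used throughout: masses of events are
    compared fibre by fibre of a countably-valued map. *)
Lemma measure_esum_fibers d (T : measurableType d) (R : realType)
    (mu : {measure set T -> \bar R}) (C : countType) (X : T -> C) (E : set T) :
  measurable E -> (forall c, measurable (X @^-1` [set c])) ->
  mu E = \esum_(c in setT) mu (E `&` X @^-1` [set c]).
Proof.
move=> mE mX.
pose F n : set T := if pickle_inv n is Some c then E `&` X @^-1` [set c] else set0.
have FE n (c : C) : pickle_inv n = Some c -> n = pickle c.
  by move=> nc; have := @pickle_invK C n; rewrite /oapp nc.
have EF : E = \bigcup_n F n.
  apply/seteqP; split => [w Ew|w [n _]]; last first.
    by rewrite /F; case: pickle_inv => // c [].
  by exists (pickle (X w)) => //; rewrite /F pickleK_inv.
have mF n : measurable (F n).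
  by rewrite /F; case: pickle_inv => // c; exact: measurableI.
have tF : trivIset setT F.
  apply/trivIsetP => i j _ _ ij; rewrite -subset0 => w [].
  rewrite /F; case Hi : (pickle_inv i) => [a|//]; case Hj : (pickle_inv j) => [b|//].
  move=> [_ /= Xa] [_ /= Xb].
  by move: ij; rewrite (FE _ _ Hi) (FE _ _ Hj) -Xa -Xb eqxx.
rewrite {1}EF measure_semi_bigcup//; last exact: bigcup_measurable.
rewrite nneseries_esumT//.
transitivity (\esum_(n in range (@pickle C)) mu (F n)).
  rewrite [RHS]esum_mkcond; apply: eq_esum => n _.
  case: ifPn => // /negP nr; rewrite /F.
  case Hn : (pickle_inv n) => [c|]; last by rewrite measure0.
  by exfalso; apply: nr; apply/mem_set; exists c => //; rewrite (FE _ _ Hn).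
rewrite (@reindex_esum _ _ _ setT _ (@pickle C)); last first.
  split=> [c _|a b _ _ /(pcan_inj pickleK)|n]//; by exists c.
by apply: eq_esum => c _; rewrite /F pickleK_inv.
Qed.

End fibers.

(** * Total variation distance and shifts *)

Section dTV.
Context (R : realType).
Local Open Scope ereal_scope.

(** Comparing two measures atom by atom, up to a relabelling [g] of the atoms.
    With [g] the identity this is the usual domination; with [g] a unit shift it
    compares consecutive weights of a birth-death distribution. *)
Lemma le_measure_transport (m1 m2 : {measure set int -> \bar R})
    (g : int -> int) (A : set int) :
  (forall k, A k -> m1 [set k] <= m2 (g @^-1` [set k])) ->
  m1 A <= m2 (g @^-1` A).
Proof.
move=> m12.
rewrite (@measure_esum_fibers _ _ _ m1 _ id)//.
rewrite (@measure_esum_fibers _ _ _ m2 _ g)//.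
apply: le_esum => k _; rewrite preimage_id -preimage_setI.
have [Ak|nAk] := pselect (A k).
  by rewrite setI1 mem_set// m12.
by rewrite setI1 memNset// preimage_set0 !measure0.
Qed.

Lemma dTV_ge0 (Q1 Q2 : probability int R) : 0 <= dTV Q1 Q2.
Proof.
apply: ereal_sup_ubound; exists set0 => //.
by rewrite !measure0 subee// abse0.
Qed.

Lemma dTV_fin_num (Q1 Q2 : probability int R) : dTV Q1 Q2 \is a fin_num.
Proof.
rewrite ge0_fin_numE ?dTV_ge0//; apply: (@le_lt_trans _ _ 1); last exact: ltry.
apply: ge_ereal_sup => _ [A _ <-].
have f1 : Q1 A \is a fin_num by exact: fin_num_measure.
have f2 : Q2 A \is a fin_num by exact: fin_num_measure.
have := probability_le1 Q1 (A := A) I; have := probability_le1 Q2 (A := A) I.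
have := fine_ge0 (measure_ge0 Q1 A); have := fine_ge0 (measure_ge0 Q2 A).
rewrite -(fineK f1) -(fineK f2) -EFinB /= !lee_fin => ? ? ? ?.
by rewrite ler_norml; apply/andP; split; lra.
Qed.

Local Open Scope ring_scope.

Lemma le_dTV (Q1 Q2 : probability int R) A :
  fine (Q1 A) - fine (Q2 A) <= fine (dTV Q1 Q2).
Proof.
rewrite -lee_fin fineK ?dTV_fin_num// EFinB.
rewrite !fineK; try exact: fin_num_measure.
apply: le_trans (lee_abs _) _.
by apply: ereal_sup_ubound; exists A.
Qed.

Let integrable_dist (Q : probability int R) (h : int -> R) (M : R) (A : set int) :
  (forall k, `|h k| <= M) -> Q.-integrable A (EFin \o h).
Proof.
move=> hM; apply: (@integrableS _ _ _ _ setT) => //.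
by apply: (@integrable_bounded _ _ _ Q _ M).
Qed.

Let le_Rintegral_measure (Q1 Q2 : probability int R) (A : set int) (h : int -> R) (M : R) :
  (forall k, A k -> Q2 [set k] <= Q1 [set k])%E ->
  (forall k, 0 <= h k <= M) ->
  \int[Q2]_(k in A) h k <= \int[Q1]_(k in A) h k.
Proof.
move=> Q21 h0M.
have hM k : `|h k| <= M.
  by have /andP[h0 ?] := h0M k; rewrite ger0_norm.
have mA : measurable A by [].
have le21 S : measurable S -> (mrestr Q2 mA S <= mrestr Q1 mA S)%E.
  move=> _; rewrite /mrestr.
  by apply: (@le_measure_transport Q2 Q1 id) => k [_]; exact: Q21.
have restrE (Q : probability int R) :
    (\int[mrestr Q mA]_(k in A) (h k)%:E = \int[Q]_(k in A) (h k)%:E)%E.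
  apply: eq_measure_integral => S mS SA.
  by rewrite /= /mrestr; congr (Q _); apply/setIidPl.
have fin (Q : probability int R) : (\int[Q]_(k in A) (h k)%:E)%E \is a fin_num.
  apply: integrable_fin_num => //; exact: integrable_dist hM.
rewrite /Rintegral fine_le ?fin//= -!restrE; apply: (ge0_le_measure_integral le21) => //.
by move=> k; rewrite lee_fin; have /andP[] := h0M k.
Qed.

(** On the set [A] where [Q2] is dominated by [Q1] the nonnegative function
    [M - h] has a larger [Q1]-integral, and on its complement [h + M] has a
    larger [Q2]-integral.  Adding both inequalities leaves
    [2 * M * (Q1 A - Q2 A)]. *)
Lemma Rintegral_dTV (Q1 Q2 : probability int R) (h : int -> R) (M : R) :
  (forall k, `|h k| <= M) ->
  \int[Q1]_k h k - \int[Q2]_k h k <= 2 * M * fine (dTV Q1 Q2).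
Proof.
move=> hM.
pose A := [set k | Q2 [set k] <= Q1 [set k]]%E.
have h1 k : 0 <= M - h k <= 2 * M.
  by have := hM k; rewrite ler_norml => /andP[? ?]; apply/andP; split; lra.
have h2 k : 0 <= h k + M <= 2 * M.
  by have := hM k; rewrite ler_norml => /andP[? ?]; apply/andP; split; lra.
have A1 : forall k, A k -> (Q2 [set k] <= Q1 [set k])%E by [].
have A2 k : (~` A) k -> (Q1 [set k] <= Q2 [set k])%E.
  by move=> /negP; rewrite -ltNge => /ltW.
have I1 := le_Rintegral_measure A1 h1.
have I2 := le_Rintegral_measure A2 h2.
have ih (Q : probability int R) B : Q.-integrable B (EFin \o h).
  exact: integrable_dist hM.
have ic (Q : probability int R) B c : Q.-integrable B (EFin \o fun=> c).
  by apply: (@integrable_dist _ _ `|c|).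
have split_ (Q : probability int R) :
    \int[Q]_k h k = \int[Q]_(k in A) h k + \int[Q]_(k in ~` A) h k.
  rewrite -[in LHS](setUv A) Rintegral_setU ?setUv//; first exact: ih.
  by apply/disj_set2P; rewrite setICr.
have EB (Q : probability int R) B :
    \int[Q]_(k in B) (M - h k) = M * fine (Q B) - \int[Q]_(k in B) h k.
  by rewrite RintegralB ?Rintegral_cst//; [exact: ic|exact: ih].
have ED (Q : probability int R) B :
    \int[Q]_(k in B) (h k + M) = \int[Q]_(k in B) h k + M * fine (Q B).
  by rewrite RintegralD ?Rintegral_cst//; [exact: ih|exact: ic].
move: I1 I2; rewrite !EB !ED !split_.
have QC (Q : probability int R) : fine (Q (~` A)) = 1 - fine (Q A).
  have fQ : Q A \is a fin_num by exact: fin_num_measure.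
  by rewrite probability_setC// -(fineK fQ) -EFinB.
have := le_dTV Q1 Q2 A; rewrite !QC.
have M0 : 0 <= M by exact: le_trans (normr_ge0 _) (hM 0).
by move=> dA; have := ler_wpM2l M0 dA; lra.
Qed.

End dTV.

Section smoothing.
Context d (T : measurableType d) (R : realType) (P : probability T R).
Implicit Types (X : {RV P >-> int}) (h : int -> R).

(** Small when the law of [X] is smooth; it controls how much the mean of a
    bounded function changes when [X] is shifted by one. *)
Definition shift_dTV X : R :=
  fine (dTV (distribution P X) (distribution P (rv_succ X))).

Lemma shift_dTV_ge0 X : 0 <= shift_dTV X.
Proof. by rewrite fine_ge0// dTV_ge0. Qed.

Let shift1 X h (M : R) : (forall k, `|h k| <= M) ->
  `|\int[P]_w h (X w + 1) - \int[P]_w h (X w)| <= 2 * M * shift_dTV X.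
Proof.
move=> hM.
have E (Y : {RV P >-> int}) (k : int -> R) : (forall j, `|k j| <= M) ->
    \int[P]_w k (Y w) = \int[distribution P Y]_j k j.
  move=> kM; rewrite /Rintegral integral_distribution//.
  apply: (@integrable_bounded _ _ _ P _ M) => //; exact: measurable_comp_int.
rewrite (_ : \int[P]_w h (X w + 1) = \int[distribution P (rv_succ X)]_j h j);
  last exact: (E (rv_succ X)).
rewrite (E X)//.
rewrite ler_norml lerNl opprB; apply/andP; split; first exact: Rintegral_dTV.
have hM' k : `|- h k| <= M by rewrite normrN.
have := Rintegral_dTV (distribution P X) (distribution P (rv_succ X)) hM'.
have NE (Q : probability int R) : \int[Q]_k (- h k) = - \int[Q]_k h k.
  rewrite (_ : \int[Q]_k _ = \int[Q]_k (-1 * h k)); last first.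
    by apply: eq_Rintegral => k _; rewrite mulN1r.
  rewrite RintegralZl ?mulN1r//; exact: integrable_bounded hM.
by rewrite !NE /shift_dTV; lra.
Qed.

(** The first bound in the minimum is trivial; the second one is obtained by
    telescoping over unit shifts, each of which costs [2 * M * shift_dTV X]. *)
Lemma Rintegral_shift_le X h (M : R) (a b : int) : (forall k, `|h k| <= M) ->
  `|\int[P]_w h (X w + a) - \int[P]_w h (X w + b)| <=
    2 * M * Num.min 1 (shift_dTV X * `|a - b|%:~R).
Proof.
move=> hM.
have M0 : 0 <= M by exact: le_trans (normr_ge0 _) (hM 0).
rewrite minr_pMr; last by rewrite mulr_ge0.
rewrite le_min mulr1; apply/andP; split.
  have B (c : int) : `|\int[P]_w h (X w + c)| <= M.
    apply: Rintegral_le_bound => //.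
    exact: (measurable_comp_int (fun x => h (x + c))).
  by apply: le_trans (ler_normB _ _) _; have := B a; have := B b; lra.
have key (n : nat) (c : int) :
    `|\int[P]_w h (X w + (c + n%:Z)) - \int[P]_w h (X w + c)| <=
    2 * M * (shift_dTV X * n%:R).
  elim: n => [|n IH]; first by rewrite addr0 subrr normr0 !mulr0.
  have := shift1 X (fun k => hM (k + (c + n%:Z))).
  have -> : \int[P]_w h (X w + 1 + (c + n%:Z)) =
            \int[P]_w h (X w + (c + n.+1%:Z)).
    by apply: eq_Rintegral => w _; congr h; lia.
  move=> S1.
  have -> : 2 * M * (shift_dTV X * n.+1%:R) =
      2 * M * (shift_dTV X * n%:R) + 2 * M * shift_dTV X.
    by rewrite -natr1; ring.
  apply: le_trans (lerD IH S1).
  apply: le_trans (ler_normD _ _).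
  by rewrite [X in _ <= `|X|]addrC subrKA.
have [ab|/ltW ab] := leP b a.
  have [n an] : exists n : nat, a = b + n%:Z by exists (absz (a - b)); lia.
  have -> : `|a - b| = n%:Z by lia.
  by rewrite an; exact: key.
have [n bn] : exists n : nat, b = a + n%:Z by exists (absz (b - a)); lia.
have -> : `|a - b| = n%:Z by lia.
by rewrite bn distrC; exact: key.
Qed.

End smoothing.

(** * The Stein equation of a birth-death distribution *)

Section birth_death.
Context (R : realType) (Q : probability int R) (al be : int -> R) (s : R).
Let q (i : int) : R := fine (Q [set i]).
Hypothesis s_gt0 : 0 < s.
Hypothesis al_ge : forall i, s <= al i.
Hypothesis be_ge : forall i, s <= be i.
Hypothesis al_noninc : forall i j : int, i <= j -> al j <= al i.
Hypothesis be_nondec : forall i j : int, i <= j -> be i <= be j.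
Hypothesis balance : forall i, al i * q i = be (i + 1) * q (i + 1).

Let al_gt0 i : 0 < al i. Proof. exact: lt_le_trans (al_ge i). Qed.
Let be_gt0 i : 0 < be i. Proof. exact: lt_le_trans (be_ge i). Qed.
Let finQ A : Q A \is a fin_num. Proof. exact: fin_num_measure. Qed.
Let q_ge0 i : 0 <= q i. Proof. exact: fine_ge0. Qed.

Let q_eq0S i : (q i == 0) = (q (i + 1) == 0).
Proof.
apply/idP/idP => /eqP q0; move: (balance i); rewrite q0 mulr0.
  by move/esym/eqP; rewrite mulf_eq0 (gt_eqF (be_gt0 _)).
by move/eqP; rewrite mulf_eq0 (gt_eqF (al_gt0 _)).
Qed.

(** Detailed balance propagates a zero weight to all integers, which is absurd
    for a probability. *)
Let q_gt0 i : 0 < q i.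
Proof.
rewrite lt_def q_ge0 andbT; apply/negP => qi0.
have all0 j : q j == 0.
  have up (n : nat) (k : int) : (q k == 0) = (q (k + n%:Z) == 0).
    elim: n => [|n IH]; first by rewrite addr0.
    by rewrite IH q_eq0S; congr (q _ == 0); lia.
  have [ij|/ltW ij] := leP i j.
    have [n ->] : exists n : nat, j = i + n%:Z by exists (absz (j - i)); lia.
    by rewrite -up.
  have [n jn] : exists n : nat, i = j + n%:Z by exists (absz (i - j)); lia.
  by rewrite (up n) -jn.
have : (Q setT = 0)%E.
  rewrite (@measure_esum_fibers _ _ _ Q _ id)//; apply: esum1 => k _.
  have qk : Q [set k] = (q k)%:E by rewrite /q fineK.
  by rewrite setTI preimage_id; apply: etrans qk _; rewrite (eqP (all0 k)).
by rewrite probability_setT => /eqP; rewrite onee_eq0.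
Qed.

Let lo (A : set int) (i : int) : R := fine (Q (A `&` [set k | k <= i])).
Let up (A : set int) (i : int) : R := fine (Q (A `&` [set k | i < k])).

Let fineQU (A B : set int) : A `&` B = set0 ->
  fine (Q (A `|` B)) = fine (Q A) + fine (Q B).
Proof. by move=> AB; rewrite measureU// fineD ?finQ. Qed.

Let at_ (A : set int) (i : int) : R := if i \in A then q i else 0.

Let atE A i : fine (Q (A `&` [set i])) = at_ A i.
Proof. by rewrite setI1 /at_; case: ifP => // _; rewrite measure0. Qed.

Let loS A i : lo A i = lo A (i - 1) + at_ A i.
Proof.
rewrite -atE /lo -fineQU; last first.
  by rewrite -subset0 => k [[_ /= ?] [_ /= ?]]; lia.
rewrite -setIUr; congr (fine (Q (_ `&` _))); apply/seteqP; split => k /=; first lia.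
by case; lia.
Qed.

Let upS A i : up A (i - 1) = up A i + at_ A i.
Proof.
rewrite -atE /up -fineQU; last first.
  by rewrite -subset0 => k [[_ /= ?] [_ /= ?]]; lia.
rewrite -setIUr; congr (fine (Q (_ `&` _))); apply/seteqP; split => k /=; first lia.
by case; lia.
Qed.

Let lo_up A i : fine (Q A) = lo A i + up A i.
Proof.
rewrite /lo /up -fineQU; last first.
  by rewrite -subset0 => k [[_ /= ?] [_ /= ?]]; lia.
rewrite -setIUr [X in A `&` X](_ : _ = setT) ?setIT//.
by apply/seteqP; split => k //= _; lia.
Qed.

Let total i : lo setT (i - 1) + q i + up setT i = 1.
Proof.
have := lo_up setT i; rewrite probability_setT loS /at_ in_setT => /= ->.
by rewrite addrAC.
Qed.

Let le_transport (c1 c2 : R) (g : int -> int) (A : set int) :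
  0 <= c1 -> 0 <= c2 ->
  (forall k, A k -> c1 * q k <= c2 * fine (Q (g @^-1` [set k]))) ->
  c1 * fine (Q A) <= c2 * fine (Q (g @^-1` A)).
Proof.
move=> c10 c20 H.
rewrite -lee_fin !EFinM !fineK//.
apply: (@le_measure_transport _ (mscale (NngNum c10) Q) (mscale (NngNum c20) Q)).
move=> k Ak; rewrite /= /mscale /=.
by have := H k Ak; rewrite -lee_fin !EFinM /q !fineK.
Qed.

(** This and [up_le] say that the ratios of the left tail, and of the right
    tail, to [al i * q i] are monotone in [i].  For [k < i],
    [al i * q k <= al k * q k = be (k + 1) * q (k + 1) <= be i * q (k + 1)];
    summing over [k] compares the left tail with its translate. *)
Let lo_le i : al i * lo setT (i - 1) <= be i * (lo setT (i - 1) + q i).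
Proof.
have -> : lo setT (i - 1) + q i = lo setT i by rewrite [RHS]loS /at_ in_setT.
rewrite /lo !setTI.
rewrite (_ : [set k | k <= i] = (fun k => k - 1) @^-1` [set k | k <= i - 1]); last first.
  by apply/seteqP; split => k /=; lia.
apply: le_transport; try exact: ltW.
move=> k /= ki; rewrite (_ : _ @^-1` _ = [set k + 1]); last first.
  by apply/seteqP; split => j /=; lia.
rewrite -/(q _).
apply: (@le_trans _ _ (al k * q k)).
  by apply: ler_wpM2r => //; apply: al_noninc; lia.
rewrite balance; apply: ler_wpM2r; first exact: q_ge0.
by apply: be_nondec; lia.
Qed.

Let up_le i : be i * up setT i <= al i * (up setT i + q i).
Proof.
have -> : up setT i + q i = up setT (i - 1) by rewrite [RHS]upS /at_ in_setT.
rewrite /up !setTI.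
rewrite (_ : [set k | i - 1 < k] = (fun k => k + 1) @^-1` [set k | i < k]); last first.
  by apply/seteqP; split => k /=; lia.
apply: le_transport; try exact: ltW.
move=> k /= ki; rewrite (_ : _ @^-1` _ = [set k - 1]); last first.
  by apply/seteqP; split => j /=; lia.
rewrite -/(q _).
apply: (@le_trans _ _ (be k * q k)).
  by apply: ler_wpM2r => //; apply: be_nondec; lia.
have := balance (k - 1); rewrite subrK => <-; apply: ler_wpM2r; first exact: q_ge0.
by apply: al_noninc; lia.
Qed.

(** The increment of the Stein solution at [i], in coordinates: [p] is the
    weight of [i], [x] and [y] are the masses on its left and right, and [L],
    [v], [U] are the masses of [A] on the left of [i], at [i] and on its right.
    The contributions of [L] and [U] are nonpositive by monotonicity of the tail
    ratios, so only the mass [v] of [A] at [i] itself counts. *)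
Let diff_le (a b x y p L U v : R) : s <= a -> s <= b ->
  0 < p -> 0 <= x -> 0 <= y -> x + p + y = 1 ->
  a * x <= b * (x + p) -> b * y <= a * (y + p) ->
  0 <= L -> 0 <= U -> 0 <= v <= p ->
  ((L + v) * y - U * (x + p)) / (a * p) - (L * (y + p) - (U + v) * x) / (b * p)
    <= s^-1.
Proof.
move=> sa sb p0 x0 y0 xyp ax by_ L0 U0 /andP[v0 vp].
have a0 : 0 < a by exact: lt_le_trans sa.
have b0 : 0 < b by exact: lt_le_trans sb.
have -> : ((L + v) * y - U * (x + p)) / (a * p) - (L * (y + p) - (U + v) * x) / (b * p)
  = v / p * (y / a + x / b) - L * (a * (y + p) - b * y) / (a * b * p)
    - U * (b * (x + p) - a * x) / (a * b * p).
  by field; rewrite !gt_eqF.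
have abp0 : 0 < a * b * p by rewrite !mulr_gt0.
have i1 : 0 <= L * (a * (y + p) - b * y) / (a * b * p).
  by rewrite divr_ge0 ?(ltW abp0)// mulr_ge0// subr_ge0.
have i2 : 0 <= U * (b * (x + p) - a * x) / (a * b * p).
  by rewrite divr_ge0 ?(ltW abp0)// mulr_ge0// subr_ge0.
have vp1 : 0 <= v / p <= 1 by rewrite divr_ge0 ?(ltW p0)//= ler_pdivrMr// mul1r.
have ya : y / a <= y / s by rewrite ler_wpM2l// lef_pV2.
have xb : x / b <= x / s by rewrite ler_wpM2l// lef_pV2.
have z0 : 0 <= y / a + x / b by rewrite addr_ge0// divr_ge0// ltW.
have zs : y / a + x / b <= s^-1.
  apply: (le_trans (lerD ya xb)); rewrite -mulrDl ler_piMl ?invr_ge0 ?(ltW s_gt0)//.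
  by lra.
have /andP[vp0 vp1'] := vp1.
have : v / p * (y / a + x / b) <= s^-1.
  by apply: le_trans zs; rewrite ler_piMl.
by lra.
Qed.

(** Solving the first-order recurrence from the left gives the numerator
    [Q (A up to i - 1) - Q A * Q (up to i - 1)], written here in the symmetric
    form in which both tails appear with a definite sign. *)
Let stein_sol (A : set int) (i : int) : R :=
  (lo A (i - 1) * (up setT i + q i) - (up A i + at_ A i) * lo setT (i - 1)) /
  (be i * q i).

(** Balance gives the value at [i + 1] the denominator [al i * q i]. *)
Let stein_solS A i : stein_sol A (i + 1) =
  ((lo A (i - 1) + at_ A i) * up setT i - up A i * (lo setT (i - 1) + q i)) /
  (al i * q i).
Proof.
rewrite /stein_sol addrK -balance; congr (_ / _).
have u B : up B (i + 1) + at_ B (i + 1) = up B i by rewrite -upS addrK.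
have -> : q (i + 1) = at_ setT (i + 1) by rewrite /at_ in_setT.
by rewrite !u (loS A) (loS setT) /at_ in_setT.
Qed.

Let at_bound A i : 0 <= at_ A i <= q i.
Proof. by rewrite /at_; case: ifP; rewrite ?lexx ?q_ge0. Qed.

Let lo_ge0 A i : 0 <= lo A i. Proof. exact: fine_ge0. Qed.
Let up_ge0 A i : 0 <= up A i. Proof. exact: fine_ge0. Qed.

Let loC A i : lo (~` A) i = lo setT i - lo A i.
Proof.
apply/eqP; rewrite eq_sym subr_eq /lo -fineQU; last first.
  by rewrite -subset0 => k [[] ? _ [? _]].
by rewrite -setIUl setvU.
Qed.

Let upC A i : up (~` A) i = up setT i - up A i.
Proof.
apply/eqP; rewrite eq_sym subr_eq /up -fineQU; last first.
  by rewrite -subset0 => k [[] ? _ [? _]].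
by rewrite -setIUl setvU.
Qed.

Let atC A i : at_ (~` A) i = q i - at_ A i.
Proof. by rewrite /at_ in_setC; case: (i \in A) => /=; rewrite ?subrr ?subr0. Qed.

Let stein_solC A i : stein_sol (~` A) i = - stein_sol A i.
Proof. by rewrite /stein_sol loC upC atC -[RHS]mulNr; congr (_ / _); ring. Qed.

Let stein_sol_diff A i : stein_sol A (i + 1) - stein_sol A i <= s^-1.
Proof.
by rewrite stein_solS; apply: diff_le.
Qed.

(** Replacing [A] by its complement changes the sign of the solution, so that
    the one-sided bound is enough. *)
Let stein_sol_diff_norm A i : `|stein_sol A (i + 1) - stein_sol A i| <= s^-1.
Proof.
rewrite ler_norml stein_sol_diff andbT.
by have := stein_sol_diff (~` A) i; rewrite !stein_solC; lra.
Qed.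

Let stein_sol_eq A i :
  al i * stein_sol A (i + 1) - be i * stein_sol A i = \1_A i - fine (Q A).
Proof.
rewrite stein_solS /stein_sol (lo_up A i) (loS A i).
have t := total i.
have -> : \1_A i = at_ A i / q i.
  rewrite indicE /at_; case: ifP => _; first by rewrite divff ?gt_eqF.
  by rewrite mul0r.
have -> : up setT i = 1 - lo setT (i - 1) - q i by lra.
by field; rewrite !gt_eqF.
Qed.

(** The solution at [i] is at most [cl i] and at most [cu i] in absolute value.
    As [cl] is nondecreasing and [cu] nonincreasing, the first bound is good for
    [i <= 0] and the second one for [0 <= i]. *)
Let cl (i : int) := lo setT (i - 1) / (be i * q i).
Let cu (i : int) := (up setT i + q i) / (be i * q i).

Let clS i : cl i <= cl (i + 1).
Proof.
rewrite /cl addrK -balance ler_pdivrMr ?mulr_gt0//.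
rewrite mulrAC ler_pdivlMr ?mulr_gt0// (loS setT i) /at_ in_setT.
by have := lo_le i; have := q_ge0 i; nra.
Qed.

Let cuS i : cu (i + 1) <= cu i.
Proof.
have u B : up B (i + 1) + at_ B (i + 1) = up B i by rewrite -upS addrK.
have E : up setT (i + 1) + q (i + 1) = up setT i.
  by rewrite -u /at_ in_setT.
rewrite /cu E -balance ler_pdivrMr ?mulr_gt0//.
rewrite mulrAC ler_pdivlMr ?mulr_gt0//.
by have := up_le i; have := q_ge0 i; nra.
Qed.

Let stein_sol_bounded A i : `|stein_sol A i| <= cl 0 + cu 0.
Proof.
have cl0 j : 0 <= cl j by rewrite divr_ge0 ?mulr_ge0// ltW.
have cu0 j : 0 <= cu j.
  by rewrite divr_ge0 ?mulr_ge0 ?addr_ge0// ltW.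
have t := total i; have qi := q_ge0 i.
have x0 := lo_ge0 setT (i - 1); have y0 := up_ge0 setT i.
have num : `|lo A (i - 1) * (up setT i + q i) - (up A i + at_ A i) * lo setT (i - 1)|
    <= lo setT (i - 1) * (up setT i + q i).
  have L0 := lo_ge0 A (i - 1); have U0 := up_ge0 A i; have := at_bound A i.
  have := lo_ge0 (~` A) (i - 1); rewrite loC subr_ge0 => Lx.
  have := up_ge0 (~` A) i; rewrite upC subr_ge0 => Uy /andP[a0 aq].
  have A1 : lo A (i - 1) * (up setT i + q i) <= lo setT (i - 1) * (up setT i + q i).
    by apply: ler_wpM2r => //; lra.
  have A2 : (up A i + at_ A i) * lo setT (i - 1) <= lo setT (i - 1) * (up setT i + q i).
    by rewrite mulrC; apply: ler_wpM2l => //; lra.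
  have A3 : 0 <= lo A (i - 1) * (up setT i + q i) by rewrite mulr_ge0// addr_ge0.
  have A4 : 0 <= (up A i + at_ A i) * lo setT (i - 1) by rewrite mulr_ge0// addr_ge0.
  by rewrite ler_norml; apply/andP; split; lra.
have bq : 0 < be i * q i by rewrite mulr_gt0.
have sl : `|stein_sol A i| <= cl i.
  rewrite /stein_sol /cl normrM (gtr0_norm (x := (_)^-1)) ?invr_gt0//.
  rewrite ler_pM2r ?invr_gt0//; apply: (le_trans num).
  by rewrite ler_piMr//; lra.
have su : `|stein_sol A i| <= cu i.
  rewrite /stein_sol /cu normrM (gtr0_norm (x := (_)^-1)) ?invr_gt0//.
  rewrite ler_pM2r ?invr_gt0//; apply: (le_trans num).
  by rewrite ler_piMl ?addr_ge0//; lra.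
have clm (n : nat) j : cl j <= cl (j + n%:Z).
  elim: n => [|n IH]; first by rewrite addr0.
  apply: (le_trans IH); apply: (le_trans (clS _)).
  by rewrite le_eqVlt; apply/orP; left; apply/eqP; congr cl; lia.
have cum (n : nat) j : cu (j + n%:Z) <= cu j.
  elim: n => [|n IH]; first by rewrite addr0.
  apply: le_trans IH; apply: le_trans (cuS _).
  by rewrite le_eqVlt; apply/orP; left; apply/eqP; congr cu; lia.
have [i0|/ltW i0] := leP i 0.
  apply: (le_trans sl); apply: ler_wpDr => //.
  have := clm (absz i) i; congr (_ <= cl _); lia.
apply: (le_trans su); apply: ler_wpDl => //.
have := cum (absz i) 0; congr (cu _ <= _); lia.
Qed.

Lemma birth_death_stein A : exists f : int -> R,
  [/\ exists M, forall i, `|f i| <= M,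
      forall i, `|f (i + 1) - f i| <= s^-1 &
      forall i, al i * f (i + 1) - be i * f i = \1_A i - fine (Q A)].
Proof.
exists (stein_sol A); split => //.
by exists (cl 0 + cu 0).
Qed.

End birth_death.

(** * Independence *)

Section independence.
Context d (T : measurableType d) (R : realType) (P : probability T R).
Implicit Types X Y : {RV P >-> int}.

Definition independent_pair X Y := forall A B : set int,
  P (X @^-1` A `&` Y @^-1` B) = (P (X @^-1` A) * P (Y @^-1` B))%E.

Let mpre X (A : set int) : measurable (X @^-1` A).
Proof. by rewrite -[X in measurable X]setTI; exact: measurable_funPT. Qed.

(** [Z] records all coordinates but the [i]-th, which is set to 0 so that the
    indices stay in ['I_n].  It takes countably many values and the sum of the
    others is a function of [Z]; on each fibre of [Z] the claim is mutual
    independence for singletons and [B]. *)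
Lemma independent_others n (xi : 'I_n -> {RV P >-> int}) (i : 'I_n) :
  mutually_independent xi ->
  independent_pair (rv_sub (rv_sum xi) (xi i)) (xi i).
Proof.
move=> indep A B.
pose Z (w : T) : {ffun 'I_n -> int} := [ffun j => if j == i then 0 else xi j w].
pose S (c : {ffun 'I_n -> int}) : int := \sum_j c j.
set F := xi i @^-1` B.
have WZ w : rv_sub (rv_sum xi) (xi i) w = S (Z w).
  rewrite /rv_sub /= /rv_sum /S (bigD1 i)//= addrAC subrr add0r.
  rewrite [RHS](bigD1 i)//= ffunE eqxx add0r.
  by apply: eq_bigr => j /negbTE ji; rewrite ffunE ji.
set E := _ @^-1` A.
have EE : E = [set w | A (S (Z w))].
  by apply/seteqP; split => w; rewrite /E /= WZ.
have ZE c : Z @^-1` [set c] = if c i == 0 then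
    \bigcap_(j in [set` [set~ i]%SET]) xi j @^-1` [set c j] else set0.
  case: ifPn => [/eqP ci0|ci0]; apply/seteqP; split => w //=.
  - by move=> <- j /=; rewrite !inE ffunE => /negbTE ->.
  - move=> H; apply/ffunP => j; rewrite ffunE; case: eqVneq => [->//|ji].
    by apply: H; rewrite /= !inE.
  - by move=> /ffunP /(_ i); rewrite ffunE eqxx => /esym/eqP; exact/negP.
have mZ c : measurable (Z @^-1` [set c]).
  rewrite ZE; case: ifP => // _; exact: fin_bigcap_measurable.
have fin_ (B' : set T) : measurable B' -> P B' \is a fin_num.
  by move=> ?; exact: fin_num_measure.
have PF0 : 0 <= fine (P F) by rewrite fine_ge0.
have mE : measurable E by exact: mpre.
have mF : measurable F by exact: mpre.
rewrite (@measure_esum_fibers _ _ _ P _ Z); [|exact: measurableI|exact: mZ].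
rewrite muleC -[P F]fineK ?fin_//.
transitivity (mscale (NngNum PF0) P E); last by rewrite /= /mscale.
rewrite (@measure_esum_fibers _ _ _ (mscale (NngNum PF0) P) _ Z)//.
apply: eq_esum => c _; rewrite /= /mscale /= fineK ?fin_//.
have [Ac|nAc] := pselect (A (S c)); last first.
  have E0 : E `&` Z @^-1` [set c] = set0.
    by rewrite -subset0 => w []; rewrite EE /= => + Zc; rewrite Zc.
  by rewrite setIAC E0 set0I measure0 mule0.
have -> : E `&` Z @^-1` [set c] = Z @^-1` [set c].
  by apply/setIidPr => w /= Zc; rewrite EE /= Zc.
have -> : E `&` F `&` Z @^-1` [set c] = F `&` Z @^-1` [set c].
  apply/seteqP; split => w; first by move=> [[_ ?] ?]; split.
  by move=> [Fw Zc]; split => //; split => //; rewrite EE /= Zc.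
rewrite ZE; case: ifP => ci; last by rewrite setI0 measure0 mule0.
pose A' j := if j == i then B else [set c j].
have -> : F `&` \bigcap_(j in [set` [set~ i]%SET]) xi j @^-1` [set c j] =
    \bigcap_(j in [set` [set: 'I_n]%SET]) xi j @^-1` A' j.
  apply/seteqP; split => w /=.
    move=> [Fw H] j _; rewrite /A' /=; case: eqVneq => [->//|ji].
    by apply: H; rewrite /= !inE.
  move=> H; split; first by have := H i; rewrite /A' /= eqxx; apply; rewrite inE.
  move=> j /=; rewrite !inE => ji.
  by have := H j; rewrite /A' /= (negbTE ji); apply; rewrite inE.
rewrite !indep (bigD1 i) ?inE//= /F [A' i]/A' eqxx; congr (_ * _)%E.
apply: eq_big => [j|j /andP[_ /negbTE ji]]; first by rewrite !inE.
by rewrite /A' ji.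
Qed.

(** Fubini's theorem on the joint law, which is a product by independence.  The
    last hypothesis makes every inner integral finite, so that it can be
    expressed as a real number for all values of [X] and not only for almost
    all. *)
Lemma Rintegral_indep X Y (phi : int -> int -> R) :
  independent_pair X Y ->
  P.-integrable setT (fun w => (phi (X w) (Y w))%:E) ->
  (forall a, P.-integrable setT (fun w => (phi a (Y w))%:E)) ->
  \int[P]_w phi (X w) (Y w) = \int[P]_v \int[P]_w phi (X v) (Y w).
Proof.
move=> indep ixy iy.
have mXY : measurable_fun setT (fun w => (X w, Y w)).
  by apply: measurable_fun_pair; exact: measurable_funPT.
pose Z : {mfun T >-> (int * int)%type} :=
  HB.pack (fun w => (X w, Y w)) (isMeasurableFun.Build _ _ _ _ _ mXY).
pose F (z : int * int) : \bar R := (phi z.1 z.2)%:E.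
have mF : measurable_fun setT F.
  by apply: (@measurable_comp_int2 _ (int * int)%type _ _ (fun a b => (phi a b)%:E)).
pose mX := distribution P X; pose mY := distribution P Y.
have prodE (A : set (int * int)) : measurable A ->
    distribution P Z A = (mX \x mY)%E A.
  move=> mA; apply/esym.
  apply: (@product_measure_unique _ _ _ _ _ mX mY (distribution P Z)) => // A1 A2 _ _.
  exact: indep.
have iF : (mX \x mY)%E.-integrable setT F.
  apply/integrableP; split => //.
  rewrite (eq_measure_integral (distribution P Z)); last first.
    by move=> A mA _; apply/esym; exact: prodE.
  rewrite ge0_integral_distribution//; last exact: measurableT_comp.
  by move/integrableP : ixy => [].
rewrite /Rintegral; congr fine.
transitivity (\int[distribution P Z]_z F z)%E.
  by rewrite integral_distribution.
rewrite (@eq_measure_integral _ _ _ _ (mX \x mY)%E); last first.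
  by move=> A mA _; exact: prodE.
rewrite -integral12_prod_meas1//.
have GE a : fubini_F mY F a = (\int[P]_w phi a (Y w))%:E.
  rewrite /fubini_F /F integral_distribution//=; last exact: iy.
  by rewrite /Rintegral fineK//; apply: integrable_fin_num => //; exact: iy.
have iG := integrable_fubini_F iF.
have GFE : fubini_F mY F = (fun a => (\int[P]_w phi a (Y w))%:E).
  exact/funext/GE.
rewrite GFE in iG *.
rewrite integral_distribution//.
apply/integrableP; split.
  by apply/measurable_EFinP; exact: (measurable_comp_int (fun a => \int[P]_w phi a (Y w))).
by move/integrableP : iG => [_]; rewrite ge0_integral_distribution.
Qed.

(** The two integrals are over separate copies of the sample space, so this is
    Fubini's theorem for [P \x P]. *)
Lemma Rintegral_swap X Y (phi : int -> int -> R) (M : R) :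
  (forall a b, `|phi a b| <= M) ->
  \int[P]_v \int[P]_w phi (X v) (Y w) = \int[P]_w \int[P]_v phi (X v) (Y w).
Proof.
move=> phiM.
pose F (z : T * T) : R := phi (X z.1) (Y z.2).
have mF : measurable_fun setT F.
  apply: (measurable_comp_int2 phi).
    exact: (measurableT_comp (measurable_funPT X) measurable_fst).
  exact: (measurableT_comp (measurable_funPT Y) measurable_snd).
have iF : (P \x P)%E.-integrable setT (EFin \o F).
  apply: (@integrable_bounded _ _ _ (P \x P)%E F M mF).
  by move=> z; exact: phiM.
rewrite /Rintegral; congr fine.
have E1 v : (fine (\int[P]_w (phi (X v) (Y w))%:E))%:E =
    (\int[P]_w (EFin \o F) (v, w))%E.
  rewrite fineK//; apply: integrable_fin_num => //.
  by apply: (@integrable_bounded _ _ _ P _ M) => //; exact: measurable_comp_int.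
have E2 w : (fine (\int[P]_v (phi (X v) (Y w))%:E))%:E =
    (\int[P]_v (EFin \o F) (v, w))%E.
  rewrite fineK//; apply: integrable_fin_num => //.
  apply: (@integrable_bounded _ _ _ P _ M) => //.
  exact: (measurable_comp_int (fun a => phi a (Y w))).
under eq_integral do rewrite E1.
under [RHS]eq_integral do rewrite E2.
exact: Fubini.
Qed.

End independence.

(** * Moments and zero biasing *)

Section moments.
Context d (T : measurableType d) (R : realType) (P : probability T R).
Implicit Types X Y : {RV P >-> int}.

Lemma measurable_EFin_comp_int X (f : int -> R) :
  measurable_fun setT (fun w => (f (X w))%:E).
Proof. exact: (measurable_comp_int (fun k => (f k)%:E)). Qed.

Lemma le_integrable_norm (f g : T -> R) : measurable_fun setT f ->
  (forall w, `|f w| <= g w) ->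
  P.-integrable setT (fun w => (g w)%:E) ->
  P.-integrable setT (fun w => (f w)%:E).
Proof.
move=> mf fg; apply: le_integrable => //; first exact/measurable_EFinP.
move=> w _; rewrite /= lee_fin (le_trans (fg _))//; exact: ler_norm.
Qed.

Lemma le_integrable_int X (f g : int -> R) :
  (forall k, `|f k| <= g k) ->
  P.-integrable setT (fun w => (g (X w))%:E) ->
  P.-integrable setT (fun w => (f (X w))%:E).
Proof.
by move=> fg; apply: le_integrable_norm => //; exact: measurable_comp_int.
Qed.

Lemma integrable_expectation_lty X (f : int -> R) :
  (forall k, 0 <= f k) -> ('E_P[fun w => f (X w)] < +oo)%E ->
  P.-integrable setT (fun w => (f (X w))%:E).
Proof.
move=> f0; rewrite unlock => fX; apply/integrableP; split.
  exact: measurable_EFin_comp_int.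
apply: le_lt_trans fX; rewrite le_eqVlt; apply/orP; left; apply/eqP.
by apply: eq_integral => w _; rewrite gee0_abs// lee_fin.
Qed.

Definition square_integrable X := P.-integrable setT (fun w => ((X w)%:~R ^+ 2 : R)%:E).

Lemma integrable_square_intr X : square_integrable X ->
  P.-integrable setT (fun w => ((X w)%:~R : R)%:E).
Proof.
move=> iX2; apply: (@le_integrable_int X (fun k => k%:~R) (fun k => 1 + k%:~R ^+ 2)).
  move=> k; set x : R := k%:~R.
  by rewrite ler_norml; apply/andP; split; nra.
under eq_fun do rewrite EFinD.
by apply: integrableD => //; exact: (finite_measure_integrable_cst P 1).
Qed.

Lemma rv_meanE X : rv_mean X = \int[P]_w (X w)%:~R.
Proof. by rewrite /rv_mean unlock. Qed.

Lemma rv_varE X : rv_var X = \int[P]_w ((X w)%:~R - rv_mean X) ^+ 2.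
Proof.
rewrite /rv_var /variance unlock [in LHS]unlock.
by apply: eq_Rintegral => w _; rewrite expr2 rv_meanE.
Qed.

Lemma rv_var_ge0 X : 0 <= rv_var X.
Proof. by rewrite rv_varE; apply: Rintegral_ge0 => w _; exact: sqr_ge0. Qed.

Lemma integrable_centered X (c : R) : square_integrable X ->
  P.-integrable setT (fun w => ((X w)%:~R - c)%:E).
Proof.
move=> /integrable_square_intr iX.
under eq_fun do rewrite EFinB.
by apply: integrableB => //; exact: finite_measure_integrable_cst.
Qed.

Lemma integrable_centered_sqr X (c : R) : square_integrable X ->
  P.-integrable setT (fun w => (((X w)%:~R - c) ^+ 2)%:E).
Proof.
move=> iX2.
apply: (@le_integrable_int X (fun k => (k%:~R - c) ^+ 2)
  (fun k => 2 * k%:~R ^+ 2 + 2 * c ^+ 2)).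
  move=> k; rewrite ger0_norm ?sqr_ge0//.
  by have := sqr_ge0 (k%:~R + c); rewrite !expr2; lra.
under eq_fun do rewrite EFinD EFinM.
apply: integrableD => //; first exact: integrableZl.
exact: (finite_measure_integrable_cst P (2 * c ^+ 2)).
Qed.

Lemma integrable_centered_mul X Y (c : R) (g : int -> R) (M : R) :
  square_integrable Y -> (forall k, `|g k| <= M) ->
  P.-integrable setT (fun w => (((Y w)%:~R - c) * g (X w))%:E).
Proof.
move=> iY gM.
have M0 : 0 <= M by exact: le_trans (normr_ge0 _) (gM 0).
apply: (@le_integrable_norm _ (fun w => M * `|(Y w)%:~R - c|)).
- apply: (measurable_comp_int2 (fun a b => (a%:~R - c) * g b));
  exact: measurable_funPT.
- by move=> w; rewrite normrM mulrC ler_wpM2r.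
- under eq_fun do rewrite EFinM.
  apply: integrableZl => //; exact: (integrable_norm (integrable_centered c iY)).
Qed.

Lemma Rintegral_centered X : square_integrable X ->
  \int[P]_w ((X w)%:~R - rv_mean X) = 0.
Proof.
move=> iX; rewrite RintegralB//.
- by rewrite Rintegral_cstP -rv_meanE subrr.
- exact: integrable_square_intr.
- exact: finite_measure_integrable_cst.
Qed.

Lemma Rintegral_sum (I : Type) (r : seq I) (f : I -> T -> R) :
  (forall i, P.-integrable setT (EFin \o f i)) ->
  \int[P]_w (\sum_(i <- r) f i w) = \sum_(i <- r) \int[P]_w f i w.
Proof.
move=> fi; elim: r => [|i r IH].
  by under eq_Rintegral do rewrite big_nil; rewrite Rintegral_cstP big_nil.
under eq_Rintegral do rewrite big_cons.
rewrite RintegralD// ?IH ?big_cons//.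
have -> : EFin \o (fun w => \sum_(j <- r) f j w) =
    (fun w => \sum_(j <- r) (EFin \o f j) w)%E.
  by apply/funext => w /=; rewrite sumEFin.
by apply: integrable_sum.
Qed.

Lemma integrable_fdiff X (f : int -> R) (M : R) : (forall k, `|f k| <= M) ->
  P.-integrable setT (fun w => (fdiff f (X w))%:E).
Proof.
move=> fM; apply: (@integrable_bounded _ _ _ P _ (M + M)).
  exact: measurable_comp_int.
by move=> w; apply: le_trans (ler_normB _ _) _; rewrite lerD.
Qed.

(** When the variance vanishes the identity reads [0 = 0], since then
    [Y] is almost surely equal to its mean; this lets every summand be treated
    alike. *)
Lemma zero_biased_Rintegral Y Ystar (f : int -> R) (M : R) :
  square_integrable Y -> (forall k, `|f k| <= M) ->
  (0 < rv_var Y -> zero_biased Y Ystar) ->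
  \int[P]_w (((Y w)%:~R - rv_mean Y) * f (Y w)) =
  rv_var Y * \int[P]_w fdiff f (Ystar w).
Proof.
move=> iY fM zb.
have M0 : 0 <= M by exact: le_trans (normr_ge0 _) (fM 0).
have [v0|] := ltP 0 (rv_var Y).
  have fb : bounded_fun f.
    exists M; split; first exact: num_real.
    by move=> N MN k _; apply: le_trans (fM k) (ltW MN).
  have := zb v0 f fb; rewrite unlock => E.
  rewrite /Rintegral E fineM//; apply: integrable_fin_num => //.
  exact: integrable_fdiff fM.
rewrite le_eqVlt ltNge rv_var_ge0 orbF => /eqP v0; rewrite v0 mul0r.
(* The integrand is at most [e + c * (Y - m) ^+ 2], whose integral is [e]. *)
apply/eqP; rewrite -normr_le0; apply/ler_addgt0Pl => e e0; rewrite addr0.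
have Me : 0 < M + 1 by lra.
have iYf : P.-integrable setT (fun w => (((Y w)%:~R - rv_mean Y) * f (Y w))%:E).
  exact: integrable_centered_mul fM.
apply: (le_trans (le_normr_Rintegral _ iYf)) => //.
pose c := (M + 1) ^+ 2 / e.
have iB : P.-integrable setT (fun w => (c * ((Y w)%:~R - rv_mean Y) ^+ 2)%:E).
  under eq_fun do rewrite EFinM.
  by apply: integrableZl => //; exact: integrable_centered_sqr.
apply: (@le_trans _ _ (\int[P]_w (c * ((Y w)%:~R - rv_mean Y) ^+ 2 + e))).
  apply: le_Rintegral => //.
  - exact: (integrable_norm iYf).
  - exact: (integrableD measurableT iB (finite_measure_integrable_cst P e measurableT)).
  - move=> w _; set x := _ - _; rewrite normrM.
    apply: (@le_trans _ _ (`|x| * (M + 1))).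
      by rewrite ler_wpM2l// (le_trans (fM _))// lerDl.
    have -> : c * x ^+ 2 = (`|x| * (M + 1)) ^+ 2 / e.
      by rewrite /c exprMn real_normK ?num_real//; ring.
    set z := _ * (M + 1); have z0 : 0 <= z by rewrite mulr_ge0// ltW.
    have [ze|/ltW ez] := leP z e.
      by apply: (le_trans ze); rewrite lerDr divr_ge0 ?sqr_ge0// ltW.
    apply: (@le_trans _ _ (z ^+ 2 / e)); last by rewrite lerDl ltW.
    by rewrite expr2 -mulrA ler_peMr// ler_pdivlMr// mul1r.
rewrite RintegralD//; last exact: finite_measure_integrable_cst.
rewrite Rintegral_cstP RintegralZl//; last exact: integrable_centered_sqr.
by rewrite -rv_varE v0 mulr0 add0r.
Qed.

End moments.

(** * Averages over independent copies *)

Section averages.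
Context d (T : measurableType d) (R : realType) (P : probability T R).
Implicit Types X Y : {RV P >-> int}.

(** The mean of [h (X + Y')] where [Y'] is a copy of [Y] independent of [X].
    It depends on the laws of [X] and [Y] only, so that summands and their
    zero-biased versions can be exchanged inside it. *)
Definition indep_mean X Y (h : int -> R) : R :=
  \int[P]_v \int[P]_w h (X v + Y w).

Let inner X Y (h : int -> R) (M : R) : (forall k, `|h k| <= M) ->
  P.-integrable setT (fun v => (\int[P]_w h (X v + Y w))%:E).
Proof.
move=> hM; apply: (@integrable_bounded _ _ _ P _ M).
  exact: (measurable_comp_int (fun a => \int[P]_w h (a + Y w))).
move=> v; apply: Rintegral_le_bound => //.
exact: (measurable_comp_int (fun b => h (X v + b))).
Qed.

Lemma indep_meanD X Y (h k : int -> R) (M : R) :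
  (forall j, `|h j| <= M) -> (forall j, `|k j| <= M) ->
  indep_mean X Y (fun j => h j + k j) = indep_mean X Y h + indep_mean X Y k.
Proof.
move=> hM kM; rewrite /indep_mean -RintegralD//; try exact: inner.
apply: eq_Rintegral => v _; rewrite RintegralD//.
- apply: (@integrable_bounded _ _ _ P _ M) => //.
  exact: (measurable_comp_int (fun b => h (X v + b))).
- apply: (@integrable_bounded _ _ _ P _ M) => //.
  exact: (measurable_comp_int (fun b => k (X v + b))).
Qed.

Lemma indep_meanE X Y (h : int -> R) (M : R) : independent_pair X Y ->
  (forall j, `|h j| <= M) -> \int[P]_w h (X w + Y w) = indep_mean X Y h.
Proof.
move=> XY hM; apply: (@Rintegral_indep _ _ _ P X Y (fun a b => h (a + b))) => //.
  apply: (@integrable_bounded _ _ _ P _ M) => //.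
  by apply: (measurable_comp_int2 (fun a b => h (a + b))); exact: measurable_funPT.
move=> a; apply: (@integrable_bounded _ _ _ P _ M) => //.
exact: (measurable_comp_int (fun b => h (a + b))).
Qed.

(** The common source of the truncated and of the untruncated bound. *)
Definition shift_cost X (Y1 Y2 : T -> int) (w : T) : R :=
  Num.min 1 (shift_dTV X * `|Y1 w - Y2 w|%:~R).

Lemma shift_cost_bounds X Y1 Y2 w : 0 <= shift_cost X Y1 Y2 w <= 1.
Proof.
rewrite /shift_cost le_min ler01 ge_min lexx /= andbT.
by rewrite mulr_ge0 ?shift_dTV_ge0// ler0z.
Qed.

Lemma measurable_shift_cost X Y1 Y2 : measurable_fun setT (shift_cost X Y1 Y2).
Proof.
apply: (measurable_comp_int2 (fun a b => Num.min 1 (shift_dTV X * `|a - b|%:~R)));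
exact: measurable_funPT.
Qed.

Lemma integrable_shift_cost X Y1 Y2 :
  P.-integrable setT (fun w => (shift_cost X Y1 Y2 w)%:E).
Proof.
apply: (@integrable_bounded _ _ _ P _ 1); first exact: measurable_shift_cost.
by move=> w; have /andP[c0 c1] := shift_cost_bounds X Y1 Y2 w; rewrite ger0_norm.
Qed.

(** After exchanging the integrals the inner one is a mean of [h] at [X] shifted
    by a constant, to which [Rintegral_shift_le] applies. *)
Lemma indep_mean_shift X Y1 Y2 (h : int -> R) (M : R) : (forall j, `|h j| <= M) ->
  `|indep_mean X Y1 h - indep_mean X Y2 h| <=
    2 * M * \int[P]_w shift_cost X Y1 Y2 w.
Proof.
move=> hM.
have swapE Y : indep_mean X Y h = \int[P]_w \int[P]_v h (X v + Y w).
  exact: (@Rintegral_swap _ _ _ P X Y (fun a b => h (a + b)) M).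
have avg Y (b : int) : `|\int[P]_v h (X v + b)| <= M.
  apply: Rintegral_le_bound => //.
  exact: (measurable_comp_int (fun a => h (a + b))).
have iavg Y : P.-integrable setT (fun w => (\int[P]_v h (X v + Y w))%:E).
  apply: (@integrable_bounded _ _ _ P _ M) => //; last by move=> w; exact: avg.
  exact: (measurable_comp_int (fun b => \int[P]_v h (X v + b))).
rewrite !swapE -RintegralB//; try exact: iavg.
have iD := integrableB measurableT (iavg Y1) (iavg Y2).
apply: (le_trans (le_normr_Rintegral _ iD)) => //.
rewrite -RintegralZl//; last exact: integrable_shift_cost.
apply: le_Rintegral => //.
- exact: (integrable_norm iD).
- exact: (integrableZl measurableT (2 * M) (integrable_shift_cost X Y1 Y2)).
- by move=> w _; exact: Rintegral_shift_le.
Qed.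

End averages.

(** * Sums of independent variables *)

Section sums.
Context d (T : measurableType d) (R : realType) (P : probability T R).
Context (n : nat) (xi : 'I_n -> {RV P >-> int}).
Hypothesis indep : mutually_independent xi.
Hypothesis sqr_int : forall i, square_integrable (xi i).

Let W : {RV P >-> int} := rv_sum xi.
Let others (i : 'I_n) : {RV P >-> int} := rv_sub W (xi i).

Let othersE i w : others i w + xi i w = W w. Proof. exact: subrK. Qed.

Let intrW w : (W w)%:~R = \sum_i (xi i w)%:~R :> R.
Proof. by rewrite /W /= /rv_sum rmorph_sum. Qed.

Let integrable_sqrD (f g : T -> R) :
  measurable_fun setT f -> measurable_fun setT g ->
  P.-integrable setT (fun w => (f w ^+ 2)%:E) ->
  P.-integrable setT (fun w => (g w ^+ 2)%:E) ->
  P.-integrable setT (fun w => ((f w + g w) ^+ 2)%:E).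
Proof.
move=> mf mg if_ ig.
apply: (@le_integrable_norm _ _ _ P _ (fun w => 2 * f w ^+ 2 + 2 * g w ^+ 2)).
- by apply: measurable_funX; exact: measurable_funD.
- by move=> w; rewrite ger0_norm ?sqr_ge0//; have := sqr_ge0 (f w - g w); nra.
- under eq_fun do rewrite EFinD !EFinM.
  by apply: integrableD => //; exact: integrableZl.
Qed.

Lemma square_integrable_rv_sum : square_integrable W.
Proof.
rewrite /square_integrable; under eq_fun do rewrite intrW.
elim: (index_enum _) => [|i r IH].
  under eq_fun do rewrite big_nil.
  exact: finite_measure_integrable_cst.
under eq_fun do rewrite big_cons.
apply: integrable_sqrD => //; first exact: measurable_comp_int.
  by apply: measurable_sum => j; exact: measurable_comp_int.
exact: sqr_int.
Qed.

Lemma square_integrable_others i : square_integrable (others i).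
Proof.
rewrite /square_integrable.
have -> : (fun w => ((others i w)%:~R ^+ 2 : R)%:E) =
    (fun w => (((W w)%:~R + - (xi i w)%:~R) ^+ 2 : R)%:E).
  by apply/funext => w; rewrite -rmorphN -rmorphD.
apply: (integrable_sqrD (f := fun w => (W w)%:~R)
  (g := fun w => - (xi i w)%:~R)).
- exact: (@measurable_comp_int _ T _ R (fun k => k%:~R) W).
- exact: (@measurable_comp_int _ T _ R (fun k => - k%:~R) (xi i)).
  exact: square_integrable_rv_sum.
by under eq_fun do rewrite sqrrN; exact: sqr_int.
Qed.

Lemma rv_mean_sum : rv_mean W = \sum_i rv_mean (xi i).
Proof.
rewrite rv_meanE; under eq_Rintegral do rewrite intrW.
rewrite Rintegral_sum; first by apply: eq_bigr => i _; rewrite rv_meanE.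
by move=> i; exact: integrable_square_intr.
Qed.

Let centerW w : (W w)%:~R - rv_mean W = \sum_i ((xi i w)%:~R - rv_mean (xi i)).
Proof. by rewrite intrW rv_mean_sum -sumrB. Qed.

(** Expand one of the two factors of [(W - mu) ^+ 2] over the summands; each
    covariance of [xi i] with the sum of the others vanishes by independence. *)
Lemma rv_var_sum : rv_var W = \sum_i rv_var (xi i).
Proof.
rewrite rv_varE.
under eq_Rintegral do rewrite expr2 {1}centerW mulr_suml.
pose cov i w : R := ((xi i w)%:~R - rv_mean (xi i)) *
  ((others i w)%:~R - (rv_mean W - rv_mean (xi i))).
have icov i : P.-integrable setT (fun w => (cov i w)%:E).
  apply: (@le_integrable_norm _ _ _ P _ (fun w =>
    ((xi i w)%:~R - rv_mean (xi i)) ^+ 2 +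
    ((others i w)%:~R - (rv_mean W - rv_mean (xi i))) ^+ 2)).
  - apply: (measurable_comp_int2 (fun a b => (a%:~R - rv_mean (xi i)) *
      (b%:~R - (rv_mean W - rv_mean (xi i))))); exact: measurable_funPT.
  - move=> w; rewrite /cov; set x := _ - _; set y := _ - _.
    have := sqr_ge0 (x + y); have := sqr_ge0 (x - y).
    have := sqr_ge0 x; have := sqr_ge0 y.
    by rewrite ler_norml => ? ? ? ?; apply/andP; split; nra.
  - under eq_fun do rewrite EFinD.
    apply: integrableD => //; apply: integrable_centered_sqr => //.
    exact: square_integrable_others.
have cov0 i : \int[P]_w cov i w = 0.
  rewrite (@Rintegral_indep _ _ _ P (others i) (xi i) (fun a b =>
      (b%:~R - rv_mean (xi i)) * (a%:~R - (rv_mean W - rv_mean (xi i))))) //.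
  - rewrite -[RHS](@Rintegral_cstP _ _ _ P 0); apply: eq_Rintegral => v _.
    rewrite RintegralZr//; last exact: integrable_centered.
    by rewrite Rintegral_centered ?mul0r.
  - exact: independent_others.
  - exact: icov.
  - move=> a; under eq_fun do rewrite mulrC EFinM.
    by apply: integrableZl => //; exact: integrable_centered.
have splitE i w : ((xi i w)%:~R - rv_mean (xi i)) * ((W w)%:~R - rv_mean W) =
    cov i w + ((xi i w)%:~R - rv_mean (xi i)) ^+ 2.
  by rewrite /cov -(othersE i) intrD; ring.
have isq i := integrable_centered_sqr (rv_mean (xi i)) (sqr_int i).
rewrite Rintegral_sum => [|i].
  apply: eq_bigr => i _; under eq_Rintegral do rewrite splitE.
  by rewrite RintegralD//; [rewrite cov0 add0r -rv_varE|exact: icov|exact: isq].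
rewrite [_ \o _](_ : _ = fun w => (cov i w)%:E +
    (((xi i w)%:~R - rv_mean (xi i)) ^+ 2)%:E)%E; last first.
  by apply/funext => w /=; rewrite -EFinD splitE.
exact: integrableD.
Qed.

(** The zero bias of a sum: replace one summand, chosen with probability
    proportional to its variance, by its zero-biased version. *)
Lemma Rintegral_centered_mul_sum (xistar : 'I_n -> {RV P >-> int}) (g : int -> R) (M : R) :
  (forall i, 0 < rv_var (xi i) -> zero_biased (xi i) (xistar i)) ->
  (forall k, `|g k| <= M) ->
  \int[P]_w (((W w)%:~R - rv_mean W) * g (W w)) =
  \sum_i rv_var (xi i) * indep_mean (others i) (xistar i) (fdiff g).
Proof.
move=> zb gM.
under eq_Rintegral do rewrite centerW mulr_suml.
rewrite Rintegral_sum; last by move=> i; exact: integrable_centered_mul gM.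
apply: eq_bigr => i _.
transitivity (\int[P]_w (((xi i w)%:~R - rv_mean (xi i)) * g (others i w + xi i w))).
  by apply: eq_Rintegral => w _; rewrite othersE.
rewrite (@Rintegral_indep _ _ _ P (others i) (xi i) (fun a b =>
  (b%:~R - rv_mean (xi i)) * g (a + b))); first last.
- by move=> a; exact: (@integrable_centered_mul _ _ _ P _ _ _ (fun b => g (a + b)) M).
- under eq_fun do rewrite othersE.
  exact: integrable_centered_mul gM.
- exact: independent_others.
rewrite -RintegralZl//.
  apply: eq_Rintegral => v _.
  rewrite (@zero_biased_Rintegral _ _ _ P _ (xistar i) (fun b => g (others i v + b)) M) //.
  - by congr (_ * _); apply: eq_Rintegral => w _; rewrite /fdiff addrA.
  - exact: zb.
have gM2 k : `|fdiff g k| <= M + M.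
  by apply: le_trans (ler_normB _ _) _; rewrite lerD.
apply: (@integrable_bounded _ _ _ P _ (M + M)).
  exact: (measurable_comp_int (fun a => \int[P]_w fdiff g (a + xistar i w))).
move=> v; apply: Rintegral_le_bound => //.
exact: (measurable_comp_int (fun b => fdiff g (others i v + b))).
Qed.

End sums.

(** * The Stein equation and the basic estimate *)

Section stein.
Context (R : realType).

(** The characterizing identity for the indicator of [i + 1]. *)
Lemma is_Psi_balance (kappa : int) (mu s : R) (Q : probability int R) (i : int) :
  is_Psi kappa mu s Q ->
  (if kappa <= i then s else s + mu - i%:~R) * fine (Q [set i]) =
  (if kappa <= i + 1 then s + (i + 1)%:~R - mu else s) * fine (Q [set i + 1]).
Proof.
set c1 := if _ then _ else _; set c2 := if _ then _ else _ => PsiQ.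
pose f := \1_[set i + 1] : int -> R.
have in1 (j k : int) : \1_[set k] j = (j == k)%:R :> R.
  rewrite indicE; congr (_%:R); congr nat_of_bool.
  by apply/idP/eqP => [/set_mem//|->]; exact/mem_set.
have steinE j : stein_op kappa mu s f j = c1 * \1_[set i] j - c2 * \1_[set i + 1] j.
  rewrite /stein_op /f !in1 (inj_eq (addIr 1)).
  have [->|ji] := eqVneq j i.
    rewrite (_ : i == i + 1 = false); last by apply/negbTE; lia.
    by rewrite /c1; case: ifP => _; rewrite !mulr1 !mulr0.
  have [->|ji1] := eqVneq j (i + 1).
    by rewrite /c2; case: ifP => _; rewrite !mulr1 !mulr0.
  by case: ifP => _; rewrite !mulr0.
have fb : bounded_fun f.
  exists 1; split => // M M1 j _; rewrite /= /f in1.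
  by case: (_ == _); rewrite ?normr1 ?normr0; lra.
have iind c j : Q.-integrable setT (fun k => (c * \1_[set j] k)%:E).
  under eq_fun do rewrite EFinM.
  by apply: integrableZl => //; exact: integrable_indic.
have intE c j : \int[Q]_k (c * \1_[set j] k) = c * fine (Q [set j]).
  rewrite RintegralZl//; last exact: integrable_indic.
  by rewrite /Rintegral integral_indic// setIT.
have := congr1 fine (PsiQ f fb).
under eq_integral do rewrite steinE.
rewrite -/(Rintegral _ _ _) RintegralB//; last 2 first.
- exact: iind.
- exact: iind.
by rewrite !intE => /eqP; rewrite subr_eq0 => /eqP.
Qed.

(** With [kappa] the ceiling of [mu], the rates change regime exactly where
    [i - mu] changes sign, which makes them monotone and at least [s]. *)
Lemma Psi_stein (mu s : R) (A : set int) : 0 < s ->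
  exists f : int -> R, [/\ exists M, forall i, `|f i| <= M,
    forall i, `|fdiff f i| <= s^-1 &
    forall i, stein_op (Num.ceil mu) mu s f i = \1_A i - fine (Psi mu s A)].
Proof.
move=> s0; have [PsiQ _] := PsiP mu s0; set kappa := Num.ceil mu.
have klt : kappa%:~R - 1 < mu.
  by have := real_ceilB1_lt (num_real mu); rewrite intrB.
have kge : mu <= kappa%:~R by exact: ceil_ge.
have below (i : int) : (kappa <= i) = false -> i%:~R <= mu.
  move=> /negbT; rewrite -ltNge => ik; apply: le_trans (ltW klt).
  by rewrite -[1]/(1%:~R) -intrB ler_int; lia.
have above (i : int) : kappa <= i -> mu <= i%:~R.
  by move=> ki; apply: (le_trans kge); rewrite ler_int.
pose al (i : int) : R := if kappa <= i then s else s + mu - i%:~R.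
pose be (i : int) : R := if kappa <= i then s + i%:~R - mu else s.
have al_ge i : s <= al i by rewrite /al; case: ifP => // /below; lra.
have be_ge i : s <= be i by rewrite /be; case: ifP => // /above; lra.
have al_noninc (i j : int) : i <= j -> al j <= al i.
  move=> ij; have : i%:~R <= j%:~R :> R by rewrite ler_int.
  rewrite {1}/al; case: ifP => [_ _|kj]; first exact: al_ge.
  by rewrite /al ifF; [lra|apply/negbTE; lia].
have be_nondec (i j : int) : i <= j -> be i <= be j.
  move=> ij; have : i%:~R <= j%:~R :> R by rewrite ler_int.
  rewrite {1}/be; case: ifP => [ki|_ _]; last exact: be_ge.
  by rewrite /be ifT; [lra|lia].
have bal i := is_Psi_balance i PsiQ.
have [f [fM fd fE]] := birth_death_stein s0 al_ge be_ge al_noninc be_nondec bal A.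
exists f; split => // i; rewrite -fE /stein_op /al /be.
by case: ifP.
Qed.

End stein.

Section core.
Context d (T : measurableType d) (R : realType) (P : probability T R).
Context (n : nat) (xi xistar : 'I_n -> {RV P >-> int}).
Hypothesis indep : mutually_independent xi.
Hypothesis sqr_int : forall i, square_integrable (xi i).
Hypothesis zb : forall i, 0 < rv_var (xi i) -> zero_biased (xi i) (xistar i).

Let W : {RV P >-> int} := rv_sum xi.
Let others (i : 'I_n) : {RV P >-> int} := rv_sub W (xi i).
Let mu := rv_mean W.
Let s2 := rv_var W.
Hypothesis s2_gt0 : 0 < s2.

(** The core of the proof.  The function [g] absorbs the two cases of the Stein
    operator, and the split of [fdiff f] into [hp] and [hm] matches each value
    of [fdiff g] with a value of [fdiff f] at distance 0 or 1. *)
Lemma zero_bias_dTV_set (A : set int) :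
  `|fine (distribution P W A) - fine (Psi mu s2 A)| <=
  2 / s2 * \sum_i rv_var (xi i) *
    (\int[P]_w shift_cost (others i) (xi i) (xistar i) w +
     \int[P]_w shift_cost (others i) (xi i) (rv_succ (xistar i)) w).
Proof.
have [f [[M fM] fd fE]] := Psi_stein mu A s2_gt0.
set kappa := Num.ceil mu in fE.
pose hp (i : int) : R := if kappa <= i then fdiff f i else 0.
pose hm (i : int) : R := if kappa <= i then 0 else fdiff f i.
pose g (i : int) : R := if kappa <= i then f i else f (i + 1).
have gM i : `|g i| <= M by rewrite /g; case: ifP.
have is0 : 0 <= s2^-1 by rewrite invr_ge0 ltW.
have hpM i : `|hp i| <= s2^-1 by rewrite /hp; case: ifP; rewrite ?normr0.
have hmM i : `|hm i| <= s2^-1 by rewrite /hm; case: ifP; rewrite ?normr0.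
have fdE : fdiff f = (fun i => hp i + hm i).
  by apply/funext => i; rewrite /hp /hm; case: ifP; rewrite ?addr0 ?add0r.
have gdE : fdiff g = (fun i => hp i + hm (i + 1)).
  apply/funext => i; rewrite /hp /hm /fdiff /g.
  have [ki|ki] := leP kappa i.
    have -> : (kappa <= i + 1) = true by lia.
    by rewrite addr0.
  have [ki1|ki1] := leP kappa (i + 1); first by rewrite subrr addr0.
  by rewrite add0r.
have steinE i : stein_op kappa mu s2 f i = s2 * fdiff f i - (i%:~R - mu) * g i.
  by rewrite /stein_op /fdiff /g; case: ifP => _; ring.
have iind : P.-integrable setT (fun w => (\1_A (W w))%:E).
  apply: (@integrable_bounded _ _ _ P _ 1); first exact: measurable_comp_int.
  by move=> w; rewrite indicE; case: (_ \in _); rewrite ?normr1 ?normr0.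
have -> : fine (distribution P W A) - fine (Psi mu s2 A) =
    \int[P]_w (\1_A (W w) - fine (Psi mu s2 A)).
  rewrite RintegralB//; last exact: finite_measure_integrable_cst.
  rewrite Rintegral_cstP; congr (_ - _); rewrite /Rintegral.
  rewrite (_ : (fun w => _) = (fun w => (\1_(W @^-1` A) w)%:E)) ?integral_indic ?setIT//.
  by rewrite -[X in measurable X]setTI; exact: measurable_funPT.
under eq_Rintegral do rewrite -fE steinE.
rewrite RintegralB//; last 2 first.
- exact: (integrableZl measurableT s2 (integrable_fdiff W fM)).
- apply: integrable_centered_mul gM; exact: square_integrable_rv_sum.
rewrite RintegralZl//; last exact: integrable_fdiff fM.
rewrite (Rintegral_centered_mul_sum indep sqr_int zb gM) /s2 {1}rv_var_sum//.
rewrite mulr_suml -sumrB.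
apply: (le_trans (ler_norm_sum _ _ _)).
rewrite mulr_sumr; apply: ler_sum => i _.
rewrite -mulrBr normrM ger0_norm ?rv_var_ge0// mulrCA; apply: ler_wpM2l.
  exact: rv_var_ge0.
rewrite -/(others i).
have -> : \int[P]_w fdiff f (W w) = indep_mean (others i) (xi i) (fdiff f).
  rewrite -(@indep_meanE _ _ _ P _ _ _ s2^-1)//; last exact: independent_others.
  by apply: eq_Rintegral => w _; rewrite /= /rv_sub subrK.
have sE : indep_mean (others i) (xistar i) (fun j => hm (j + 1)) =
    indep_mean (others i) (rv_succ (xistar i)) hm.
  apply: eq_Rintegral => v _; apply: eq_Rintegral => w _.
  by rewrite /rv_succ addrA.
rewrite fdE gdE (@indep_meanD _ _ _ P _ _ _ _ s2^-1)//.
rewrite (@indep_meanD _ _ _ P _ _ _ _ s2^-1)// sE.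
rewrite opprD addrACA mulrDr; apply: (le_trans (ler_normD _ _)); apply: lerD.
  exact: indep_mean_shift.
exact: indep_mean_shift.
Qed.

End core.

(** * Bounds for the expected cost of a shift *)

Section costs.
Context d (T : measurableType d) (R : realType) (P : probability T R).
Implicit Types X Y : {RV P >-> int}.
Local Open Scope ereal_scope.

Let gap Y1 Y2 w : R := `|Y1 w - Y2 w|%:~R.

Let gap_ge0 Y1 Y2 w : (0 <= gap Y1 Y2 w)%R. Proof. by rewrite ler0z. Qed.

Let measurable_gap (phi : R -> R) Y1 Y2 :
  measurable_fun setT (fun w => phi (gap Y1 Y2 w)).
Proof.
apply: (measurable_comp_int2 (fun a b => phi (`|a - b|%:~R))).
  exact: measurable_funPT.
exact: measurable_funPT.
Qed.

Let measurable_gap_gt Y1 Y2 (K : R) : measurable [set w | (K < gap Y1 Y2 w)%R].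
Proof.
have mI := @measurable_fun_int2 _ T (fun a b => `|a - b|%R) Y1 Y2
  (measurable_funPT Y1) (measurable_funPT Y2).
have := mI measurableT [set k | (K < k%:~R)%R] Logic.I.
by rewrite setTI.
Qed.

Let EFin_Rintegral (f : T -> R) : P.-integrable setT (fun w => (f w)%:E) ->
  (\int[P]_w f w)%:E = \int[P]_w (f w)%:E.
Proof. by move=> fi; rewrite /Rintegral fineK//; exact: integrable_fin_num. Qed.

Lemma shift_cost_le_mean X Y1 Y2 :
  (\int[P]_w shift_cost X Y1 Y2 w)%:E <=
    (shift_dTV X)%:E * 'E_P[fun w => (`|Y1 w - Y2 w|%:~R)%R].
Proof.
rewrite EFin_Rintegral; last exact: integrable_shift_cost.
rewrite unlock -ge0_integralZl//.
- apply: ge0_le_integral => //.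
  + by move=> w _; rewrite lee_fin; have /andP[] := shift_cost_bounds X Y1 Y2 w.
  + by apply/measurable_EFinP; exact: measurable_shift_cost.
  + apply/measurable_EFinP.
    exact: (measurable_gap (fun x => shift_dTV X * x)%R).
  + by move=> w _; rewrite -EFinM lee_fin /shift_cost ge_min lexx orbT.
- by apply/measurable_EFinP; exact: (measurable_gap id).
- by rewrite lee_fin shift_dTV_ge0.
Qed.

Lemma measure_esum_gap Y1 Y2 (K : R) :
  P [set w | (K < gap Y1 Y2 w)%R] =
  \esum_(k in [set k : int * int | (K < `|k.1 - k.2|%:~R)%R])
     P [set w | Y1 w = k.1 /\ Y2 w = k.2].
Proof.
have mpre Y (A : set int) : measurable (Y @^-1` A).
  by rewrite -[X in measurable X]setTI; exact: measurable_funPT.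
have mE := measurable_gap_gt Y1 Y2 K.
have fiberE (k : int * int) : (fun w => (Y1 w, Y2 w)) @^-1` [set k] =
    [set w | Y1 w = k.1 /\ Y2 w = k.2].
  apply/seteqP; split => w /= => [<-//|].
  by case: k => a b /= [-> ->].
rewrite (@measure_esum_fibers _ _ _ P _ (fun w => (Y1 w, Y2 w)))//; last first.
  move=> k; rewrite fiberE; apply: measurableI.
    exact: (mpre Y1 [set k.1]).
  exact: (mpre Y2 [set k.2]).
rewrite [RHS]esum_mkcond; apply: eq_esum => k _; rewrite fiberE.
case: ifPn => [/set_mem /= kK|/negP kK].
  by congr (P _); apply/seteqP; split => w /= [] // Y1k Y2k; rewrite /gap Y1k Y2k.
suff -> : [set w | (K < gap Y1 Y2 w)%R] `&` [set w | Y1 w = k.1 /\ Y2 w = k.2] = set0.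
  by rewrite measure0.
rewrite -subset0 => w /= [Kw [Y1k Y2k]].
by apply: kK; apply/mem_set; rewrite /= -Y1k -Y2k.
Qed.

Lemma shift_cost_le_truncated X Y1 Y2 (K : R) : (0 < K)%R ->
  (\int[P]_w shift_cost X Y1 Y2 w)%:E <=
    (shift_dTV X)%:E * 'E_P[fun w => Num.min `|Y1 w - Y2 w|%:~R%R K] +
    \esum_(k in [set k : int * int | (K < `|k.1 - k.2|%:~R)%R])
       P [set w | Y1 w = k.1 /\ Y2 w = k.2].
Proof.
move=> K0; rewrite -measure_esum_gap.
pose E := [set w | (K < gap Y1 Y2 w)%R]; rewrite -/E.
have mE : measurable E := measurable_gap_gt Y1 Y2 K.
have min0 w : (0 <= Num.min (gap Y1 Y2 w) K)%R by rewrite le_min gap_ge0 ltW.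
have mmin : measurable_fun setT (fun w => (Num.min (gap Y1 Y2 w) K)%:E).
  by apply/measurable_EFinP; exact: (measurable_gap (fun x => Num.min x K)).
have mcost : measurable_fun setT
    (fun w => (shift_dTV X)%:E * (Num.min (gap Y1 Y2 w) K)%:E).
  have := measurable_gap (fun x => shift_dTV X * Num.min x K)%R Y1 Y2.
  by move/measurable_EFinP.
rewrite EFin_Rintegral; last exact: integrable_shift_cost.
rewrite unlock -ge0_integralZl//;
  [|by move=> w _; rewrite lee_fin min0|by rewrite lee_fin shift_dTV_ge0].
have -> : P E = \int[P]_w (\1_E w)%:E by rewrite integral_indic// setIT.
rewrite -ge0_integralD//.
apply: ge0_le_integral => //.
- by move=> w _; rewrite lee_fin; have /andP[] := shift_cost_bounds X Y1 Y2 w.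
- by apply/measurable_EFinP; exact: measurable_shift_cost.
- by apply: emeasurable_funD; [exact: mcost|exact/measurable_EFinP/measurable_indic].
- move=> w _; rewrite -EFinM -EFinD lee_fin -/(gap Y1 Y2 w) indicE.
  have /andP[c0 c1] := shift_cost_bounds X Y1 Y2 w.
  have [Kw|wK] := ltP K (gap Y1 Y2 w).
    rewrite mem_set//; apply: (le_trans c1); rewrite lerDr.
    by rewrite mulr_ge0 ?shift_dTV_ge0// ltW.
  rewrite memNset; last first.
    by move=> Ew; have := lt_le_trans Ew wK; rewrite ltxx.
  by rewrite addr0 /shift_cost ge_min lexx orbT.
- by move=> w _; rewrite -EFinM lee_fin mulr_ge0 ?shift_dTV_ge0//; exact: min0.
- exact/measurable_EFinP/measurable_indic.
Qed.

End costs.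

(** * Integrability of the zero-biased variable *)

Section first_moment.
Context d (T : measurableType d) (R : realType) (P : probability T R).
Implicit Types Y : {RV P >-> int}.

(** [trunc_sqr N] is a bounded version of [k * |k|]: its increment at [k] is at
    least [|k|] as long as [|k| < N], it is nondecreasing, and it is dominated
    by [k ^+ 2] uniformly in [N]. *)
Let clamp (N : nat) (k : int) : int := Num.max (- N%:Z) (Num.min k N%:Z).
Let trunc_sqr (N : nat) (k : int) : R := (clamp N k * `|clamp N k|)%:~R.

Let trunc_sqr_le N k : `|trunc_sqr N k| <= k%:~R ^+ 2.
Proof.
rewrite /trunc_sqr -intr_norm -rmorphXn ler_int /= /clamp expr2.
by rewrite /Num.max /Num.min; case: ifP; case: ifP; nia.
Qed.

Let trunc_sqr_bounded N k : `|trunc_sqr N k| <= N%:R ^+ 2.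
Proof.
rewrite /trunc_sqr -intr_norm -[N%:R]/(N%:Z%:~R) -rmorphXn ler_int /= /clamp expr2.
by rewrite /Num.max /Num.min; case: ifP; case: ifP; nia.
Qed.

Let fdiff_trunc_sqr N k : (if `|k| < N%:Z then `|k| else 0)%:~R <= fdiff (trunc_sqr N) k.
Proof.
rewrite /fdiff /trunc_sqr -intrB ler_int /clamp.
by rewrite /Num.max /Num.min; do ! case: ifP; nia.
Qed.

(** Zero biasing [trunc_sqr N] bounds the mean of [|Ystar|] on the event
    [|Ystar| < N] by a third-moment constant [C / Var Y] that does not depend
    on [N]; monotone convergence concludes. *)
Lemma zero_biased_first_moment Y Ystar : square_integrable Y ->
  P.-integrable setT (fun w => (`|(Y w)%:~R| ^+ 3 : R)%:E) ->
  0 < rv_var Y -> zero_biased Y Ystar ->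
  ('E_P[fun w => `|(Ystar w)%:~R|%R] < +oo)%E.
Proof.
move=> iY2 iY3 v0 zb.
have iC : P.-integrable setT
    (fun w => (`|(Y w)%:~R| ^+ 3 + `|rv_mean Y| * (Y w)%:~R ^+ 2)%:E).
  exact: (integrableD measurableT iY3 (integrableZl measurableT `|rv_mean Y| iY2)).
set C := \int[P]_w (`|(Y w)%:~R| ^+ 3 + `|rv_mean Y| * (Y w)%:~R ^+ 2).
pose g (N : nat) w : R := (if `|Ystar w| < N%:Z then `|Ystar w| else 0)%:~R.
have g0 N w : 0 <= g N w by rewrite ler0z; case: ifP.
have mg N : measurable_fun setT (g N).
  exact: (@measurable_comp_int _ T _ R
    (fun k => (if `|k| < N%:Z then `|k| else 0)%:~R) Ystar).
have gC N : (\int[P]_w (g N w)%:E <= (C / rv_var Y)%:E)%E.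
  have ifd := integrable_fdiff (P := P) Ystar (trunc_sqr_bounded N).
  have ig : P.-integrable setT (fun w => (g N w)%:E).
    apply: (@le_integrable_norm _ _ _ P _ (fun w => fdiff (trunc_sqr N) (Ystar w))) => //.
    by move=> w; rewrite ger0_norm//; exact: fdiff_trunc_sqr.
  rewrite -[leLHS]fineK; last exact: integrable_fin_num.
  rewrite lee_fin ler_pdivlMr// mulrC.
  apply: (@le_trans _ _ (rv_var Y * \int[P]_w fdiff (trunc_sqr N) (Ystar w))).
    rewrite ler_wpM2l ?(ltW v0)//; apply: le_Rintegral => // w _.
    exact: fdiff_trunc_sqr.
  have iYf := integrable_centered_mul (P := P) Y (rv_mean Y) iY2 (trunc_sqr_bounded N).
  rewrite -(zero_biased_Rintegral iY2 (trunc_sqr_bounded N))//.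
  apply: le_Rintegral => // w _.
  apply: (le_trans (ler_norm _)); rewrite normrM.
  apply: (@le_trans _ _ ((`|(Y w)%:~R| + `|rv_mean Y|) * (Y w)%:~R ^+ 2)).
    by rewrite ler_pM// ler_normB.
  by rewrite mulrDl lerD2r [_ ^+ 3]exprS real_normK ?num_real.
have glim w : (fun N => (g N w)%:E) @ \oo --> (`|(Ystar w)%:~R : R|)%:E.
  apply: cvg_near_cst; exists (absz (Ystar w)).+1 => // N /= hN.
  by rewrite /g ifT ?intr_norm//; lia.
rewrite unlock; apply: (@le_lt_trans _ _ (C / rv_var Y)%:E); last exact: ltry.
rewrite (_ : (fun w => _) = (fun w => limn (fun N => (g N w)%:E))); last first.
  by apply/funext => w; apply/esym/cvg_lim.
have mono w : setT w -> {homo (fun N => (g N w)%:E) : a b / (a <= b)%N >-> (a <= b)%E}.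
  move=> _ a b ab; rewrite lee_fin /g ler_int.
  by case: ifP => h1; case: ifP => h2 //; lia.
have := @cvg_monotone_convergence _ T R P setT measurableT (fun N w => (g N w)%:E)
  (fun N => proj2 (measurable_EFinP setT (g N)) (mg N)) (fun N w _ => g0 N w) mono.
move=> cvgI; apply: (@cvge_to_le _ _ _ _ _ _ _ cvgI).
by apply: nearW => N; exact: gC.
Qed.

End first_moment.

(** * The total variation bound *)

Section conclusion.
Context d (T : measurableType d) (R : realType) (P : probability T R).
Context (n : nat) (xi xistar : 'I_n -> {RV P >-> int}).
Hypothesis indep : mutually_independent xi.
Hypothesis sqr_int : forall i, square_integrable (xi i).
Hypothesis zb : forall i, 0 < rv_var (xi i) -> zero_biased (xi i) (xistar i).

Let W : {RV P >-> int} := rv_sum xi.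
Let others (i : 'I_n) : {RV P >-> int} := rv_sub W (xi i).
Let mu := rv_mean W.
Let s2 := rv_var W.
Hypothesis s2_gt0 : 0 < s2.

Local Open Scope ereal_scope.

Let abs_diffE (Q1 Q2 : probability int R) (A : set int) :
  `|Q1 A - Q2 A| = (`|fine (Q1 A) - fine (Q2 A)|%R)%:E.
Proof.
by rewrite -abse_EFin EFinB !fineK//; exact: fin_num_measure.
Qed.

Lemma zero_bias_dTV : dTV (distribution P W) (Psi mu s2) <=
  (2 / s2)%:E * \sum_(i < n | (0 < rv_var (xi i))%R) (rv_var (xi i))%:E *
    ((\int[P]_w shift_cost (others i) (xi i) (xistar i) w)%R%:E +
     (\int[P]_w shift_cost (others i) (xi i) (rv_succ (xistar i)) w)%R%:E).
Proof.
apply: ge_ereal_sup => _ [A _ <-].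
apply: (@le_trans _ _
    (`|fine (distribution P W A) - fine (Psi mu s2 A)|%R)%:E).
  by rewrite le_eqVlt abs_diffE eqxx.
under eq_bigr do rewrite -EFinD -EFinM.
rewrite sumEFin -EFinM lee_fin.
apply: (le_trans (zero_bias_dTV_set indep sqr_int zb s2_gt0 A)).
rewrite ler_wpM2l ?divr_ge0 ?(ltW s2_gt0)// [leRHS]big_mkcond/=.
apply: ler_sum => i _; case: ifPn => //.
by rewrite -leNgt => v0; rewrite (le_anti (introT andP (conj v0 (rv_var_ge0 (xi i))))) mul0r.
Qed.

Lemma shift_dTVE i :
  (shift_dTV (others i))%:E =
  dTV (distribution P (others i)) (distribution P (rv_succ (others i))).
Proof. by rewrite /shift_dTV fineK ?dTV_fin_num. Qed.

End conclusion.


Local Open Scope ereal_scope.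

Theorem theorem4p2 (R : realType) (d : measure_display) (T : measurableType d)
  (P : probability T R) (n : nat) (xi xistar : 'I_n -> {RV P >-> int}) :
  mutually_independent xi ->
  (forall i : 'I_n, 'E_P[fun w => ((xi i w)%:~R ^+ 2)%R] < +oo) ->
  let W : {RV P >-> int} := rv_sum xi in
  let W_ (i : 'I_n) : {RV P >-> int} := rv_sub W (xi i) in
  let s2_ (i : 'I_n) : R := rv_var (xi i) in
  let mu : R := rv_mean W in
  let s2 : R := rv_var W in
  let dplus (i : 'I_n) : \bar R :=
    dTV (distribution P (W_ i)) (distribution P (rv_succ (W_ i))) in
  let bound : \bar R :=
    (2 / s2)%:E * \sum_(i < n | (0 < s2_ i)%R) (s2_ i)%:E * dplus i *
      ('E_P[fun w => (`|xi i w - xistar i w|%:~R)%R]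
       + 'E_P[fun w => (`|xi i w - (xistar i w + 1)|%:~R)%R]) in
  (0 < s2)%R ->
  (forall i : 'I_n, (0 < s2_ i)%R -> zero_biased (xi i) (xistar i)) ->
  [/\ forall K : R, (0 < K)%R ->
        dTV (distribution P W) (Psi mu s2) <=
          (2 / s2)%:E * \sum_(i < n | (0 < s2_ i)%R) (s2_ i)%:E * dplus i *
            ('E_P[fun w => Num.min `|xi i w - xistar i w|%:~R%R K]
             + 'E_P[fun w => Num.min `|xi i w - (xistar i w + 1)|%:~R%R K])
          + (2 / s2)%:E * \sum_(i < n | (0 < s2_ i)%R) (s2_ i)%:E *
            (\esum_(k in [set k : int * int | (K < `|k.1 - k.2|%:~R)%R])
               P [set w | xi i w = k.1 /\ xistar i w = k.2]
             + \esum_(k in [set k : int * int | (K < `|k.1 - k.2|%:~R)%R])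
               P [set w | xi i w = k.1 /\ (xistar i w + 1)%R = k.2]),
      dTV (distribution P W) (Psi mu s2) <= bound
    & (forall i : 'I_n, 'E_P[fun w => (`|(xi i w)%:~R| ^+ 3)%R] < +oo) ->
      bound \is a fin_num].
Proof.
move=> indep xi2 W W_ s2_ mu s2 dplus bound s2_gt0 zb.
have sqr_int i : square_integrable (xi i).
  by apply: (integrable_expectation_lty (f := fun k => (k%:~R ^+ 2)%R)) => // k; exact: sqr_ge0.
have dTV_le := zero_bias_dTV indep sqr_int zb s2_gt0.
have dE i : dplus i = (shift_dTV (W_ i))%:E by rewrite /dplus -shift_dTVE.
have d0 i : 0 <= dplus i by exact: dTV_ge0.
have c0 : 0 <= (2 / s2)%:E by rewrite lee_fin divr_ge0// ltW.
have gap0 (Y1 Y2 : {RV P >-> int}) w : (0 <= `|Y1 w - Y2 w|%:~R :> R)%R by rewrite ler0z.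
split.
- move=> K K0; apply: (le_trans dTV_le).
  rewrite -ge0_muleDr; last 2 first.
  + apply: sume_ge0 => i vi; rewrite mule_ge0 ?mule_ge0 ?lee_fin ?(ltW vi)//.
    rewrite adde_ge0// expectation_ge0// => w.
      by rewrite le_min gap0 ltW.
    by rewrite le_min (gap0 (xi i) (rv_succ (xistar i))) ltW.
  + apply: sume_ge0 => i vi; rewrite mule_ge0 ?lee_fin ?(ltW vi)//.
    by rewrite adde_ge0// esum_ge0.
  apply: lee_wpmul2l => //; rewrite -big_split/=; apply: lee_sum => i vi.
  rewrite -muleA -ge0_muleDr; last 2 first.
  + rewrite mule_ge0// adde_ge0// expectation_ge0// => w.
      by rewrite le_min gap0 ltW.
    by rewrite le_min (gap0 (xi i) (rv_succ (xistar i))) ltW.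
  + by rewrite adde_ge0// esum_ge0.
  apply: lee_wpmul2l; first by rewrite lee_fin ltW.
  rewrite ge0_muleDr; last 2 first.
  + by apply: expectation_ge0 => w; rewrite le_min gap0 ltW.
  + by apply: expectation_ge0 => w; rewrite le_min (gap0 (xi i) (rv_succ (xistar i))) ltW.
  rewrite addeACA dE; apply: leeD.
    exact: shift_cost_le_truncated.
  exact: (shift_cost_le_truncated (W_ i) (xi i) (rv_succ (xistar i)) K0).
- apply: (le_trans dTV_le); apply: lee_wpmul2l => //; apply: lee_sum => i vi.
  rewrite -muleA; apply: lee_wpmul2l; first by rewrite lee_fin ltW.
  rewrite ge0_muleDr; last 2 first.
  + by apply: expectation_ge0 => w; exact: gap0.
  + by apply: expectation_ge0 => w; exact: (gap0 (xi i) (rv_succ (xistar i))).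
  rewrite dE; apply: leeD; first exact: shift_cost_le_mean.
  exact: (shift_cost_le_mean (W_ i) (xi i) (rv_succ (xistar i))).
- move=> xi3; rewrite fin_numM//; apply/sum_fin_numP => i _ vi.
  have xi1 := integrable_square_intr (sqr_int i).
  have xs1 : P.-integrable setT (fun w => (`|(xistar i w)%:~R|%R : R)%:E).
    apply: (integrable_expectation_lty (f := fun k => `|k%:~R|%R)) => //.
    apply: (zero_biased_first_moment (sqr_int i) _ vi (zb i vi)).
    apply: (integrable_expectation_lty (f := fun k => (`|k%:~R| ^+ 3)%R)) => //.
  have fin_gap (c : int) : 'E_P[fun w => (`|xi i w - (xistar i w + c)|%:~R)%R] \is a fin_num.
    rewrite unlock; apply: integrable_fin_num => //.
    apply: (@le_integrable_norm _ _ _ P _ (fun w =>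
      `|(xi i w)%:~R| + (`|(xistar i w)%:~R| + `|c%:~R|))%R).
    + apply: (@measurable_comp_int2 _ T _ R (fun a b => `|a - (b + c)|%:~R)%R);
      exact: measurable_funPT.
    + move=> w; rewrite intr_norm normr_id intrB intrD.
      by apply: (le_trans (ler_normB _ _)); rewrite lerD2l ler_normD.
    + have ic := finite_measure_integrable_cst P (`|c%:~R : R|)%R measurableT.
      exact: (integrableD measurableT (integrable_norm xi1) (integrableD measurableT xs1 ic)).
  rewrite fin_numM ?fin_numM ?dE// fin_numD (fin_gap 1%R) andbT.
  by have := fin_gap 0%R; under [X in 'E_P[X]]eq_fun do rewrite addr0.
Qed.
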